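(* Let $\mathfrak{g}$ be a filiform Lie algebra of dimension $14$ over a field $k$ of characteristic zero with law $\lambda\in\mathcal{A}_{14}$, normalized so that $\alpha_{2,5}=1$. Then: (1) if $\lambda\in\mathcal{A}_{14}^1$, there is a $2$-cocycle $\omega\in Z^2(\mathfrak{g},k)$ such that $H^2(\mathfrak{g},k)=\mathrm{span}\{[\omega_1],[\omega_2],[\omega]\}$, and $\mathfrak{g}$ is not symplectic; (2) if $\lambda\in\mathcal{A}_{14,1}^2$, there is a $2$-cocycle $\beta\in Z^2(\mathfrak{g},k)$ with $\det(\beta)\neq0$ such that $H^2(\mathfrak{g},k)=\mathrm{span}\{[\omega_1],[\omega_2],[\beta]\}$; in particular $\mathfrak{g}$ is symplectic; (3) if $\lambda\in\mathcal{A}_{14,2}^2$, then $H^2(\mathfrak{g},k)=\mathrm{span}\{[\omega_1],[\omega_2]\}$, and $\mathfrak{g}$ is not symplectic.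
   Context: For a Lie algebra $\mathfrak{g}$ put $\mathfrak{g}^0=\mathfrak{g}$, $\mathfrak{g}^j=[\mathfrak{g}^{j-1},\mathfrak{g}]$. A nilpotent Lie algebra of dimension $n$ is filiform if $\mathfrak{g}^{n-1}=0$ and $\mathfrak{g}^{n-2}\neq 0$. $H^2(\mathfrak{g},k)=Z^2(\mathfrak{g},k)/B^2(\mathfrak{g},k)$ is cohomology with trivial coefficients: $Z^2$ consists of the $\omega\in\mathrm{Hom}(\Lambda^2\mathfrak{g},k)$ with $\omega([x,y]\wedge z)-\omega([x,z]\wedge y)+\omega([y,z]\wedge x)=0$, and $B^2$ of those of the form $\omega(x\wedge y)=f([x,y])$, $f\in\mathrm{Hom}(\mathfrak{g},k)$. $\mathfrak{g}$ is symplectic if some $\omega\in Z^2(\mathfrak{g},k)$ is nondegenerate; $\det(\beta)$ is the determinant of the matrix of $\beta$ in the given basis. Laws: let $\mathcal{I}_{14}=\{(k,s): 2\le k\le 7,\ 2k+1\le s\le 14\}\cup\{(7,14)\}$. Every filiform Lie algebra of dimension $14$ has an adapted basis $(e_1,\dots,e_{14})$, i.e. one in which the brackets are $[e_1,e_i]=e_{i+1}$ for $2\le i\le 13$, $[e_1,e_{14}]=0$, and $$[e_i,e_j]=\sum_{r=1}^{14}\Bigl(\sum_{\ell=0}^{\lfloor (j-i-1)/2\rfloor}(-1)^\ell\binom{j-i-\ell-1}{\ell}\alpha_{i+\ell,\,r-j+i+2\ell+1}\Bigr)e_r,\qquad 2\le i<j\le 14,$$ with constants $\alpha_{k,s}\in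 k$ that vanish for $(k,s)\notin\mathcal{I}_{14}$. $\mathcal{A}_{14}$ is the set of such laws (families $(\alpha_{k,s})$ for which the Jacobi identity holds). $\omega_1,\omega_2\in Z^2(\mathfrak{g},k)$ are given by $\omega_1(e_2\wedge e_3)=1$, and $\omega_2(e_2\wedge e_5)=1$, $\omega_2(e_3\wedge e_4)=-1$, all values not determined by these and skew-symmetry being zero. Properties: (a) $\mathfrak{g}$ contains no one-codimensional subspace $U\supseteq\mathfrak{g}^1$ with $[U,\mathfrak{g}^1]\subseteq\mathfrak{g}^4$ (equivalently $\alpha_{2,5}\neq0$); (b) $\mathfrak{g}^{5}$ is abelian (equivalently $\alpha_{7,14}=0$); (c) $[\mathfrak{g}^1,\mathfrak{g}^1]\subseteq\mathfrak{g}^6$ (equivalently $\alpha_{3,7}=0$). If (a) holds, the adapted basis can be changed so that $\alpha_{2,5}=1$, and this normalization is assumed. $\mathcal{A}_{14}^1$ is the set of laws satisfying (a),(b),(c); $\mathcal{A}_{14}^2$ those satisfying (a),(b) but not (c). $\mathcal{A}_{14,1}^2$ is the set of laws in $\mathcal{A}_{14}^2$ (with $\alpha_{2,5}=1$) satisfying $\alpha_{3,10}=P_{14}$, and $\mathcal{A}_{14,2}^2$ the set of those not satisfying it, where $$P_{14}=\tfrac{1}{1307611305}\bigl(482832810500\,\alpha_{3,8}^3-157196008500\,\alpha_{3,8}^2\alpha_{2,6}+2223828750\,\alpha_{3,8}\alpha_{2,7}+16180336845\,\alpha_{3,8}\alpha_{2,6}^2+186801615\,\alpha_{2,8}-266859450\,\alpha_{2,7}\alpha_{2,6}-517476276\,\alpha_{2,6}^3\bigr).$$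 *)

(* Defs.v *)
From HB Require Import structures.
From mathcomp Require Import all_boot all_order all_algebra.

Set Implicit Arguments.
Unset Strict Implicit.
Unset Printing Implicit Defensive.

Import GRing.Theory.
Local Open Scope ring_scope.
Local Open Scope quotient_scope.

Section VQuot.
Variables (K : fieldType) (V : vectType K) (U : {vspace V}).

Definition vquot := @Quotient.quot V (pred_of_vspace U).

HB.instance Definition _ := GRing.Zmodule.copy vquot
  (@Quotient.quot V (pred_of_vspace U)).

Definition vpi (x : V) : vquot := \pi_(@Quotient.quot V (pred_of_vspace U)) x.

Lemma vpi_eq x y : (vpi x == vpi y) = (x - y \in U).
Proof. by rewrite (Quotient.idealrBE (pred_of_vspace U) x y). Qed.

Definition vrepr (q : vquot) : V := repr (q : @Quotient.quot V (pred_of_vspace U)).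

Lemma vreprK : cancel vrepr vpi.
Proof. exact: reprK. Qed.

Fact vpi_is_zmod_morphism : zmod_morphism vpi.
Proof. exact: (pi_is_zmod_morphism (@Quotient.quot V (pred_of_vspace U))). Qed.

HB.instance Definition _ :=
  GRing.isZmodMorphism.Build V vquot vpi vpi_is_zmod_morphism.
Definition vqscale (a : K) (q : vquot) : vquot := vpi (a *: vrepr q).

Fact vpiZ a x : vqscale a (vpi x) = vpi (a *: x).
Proof.
apply/eqP; rewrite vpi_eq -scalerBr rpredZ // -vpi_eq vreprK //.
Qed.

Fact vqscalerA a b q : vqscale a (vqscale b q) = vqscale (a * b) q.
Proof. by rewrite -(vreprK q) !vpiZ scalerA. Qed.

Fact vqscale1 : left_id 1 vqscale.
Proof. by move=> q; rewrite -(vreprK q) vpiZ scale1r. Qed.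

Fact vqscaleDr : right_distributive vqscale +%R.
Proof.
by move=> a p q; rewrite -(vreprK p) -(vreprK q) -raddfD !vpiZ scalerDr raddfD.
Qed.

Fact vqscaleDl q : {morph vqscale^~ q : a b / a + b}.
Proof. by move=> a b; rewrite -(vreprK q) !vpiZ scalerDl raddfD. Qed.

HB.instance Definition _ := GRing.Zmodule_isLmodule.Build K vquot
  vqscalerA vqscale1 vqscaleDr vqscaleDl.

Fact vpi_is_linear : linear vpi.
Proof. by move=> a x y; rewrite raddfD /= -vpiZ. Qed.
HB.instance Definition _ := GRing.isLinear.Build K V vquot _ vpi vpi_is_linear.

(* V/U is isomorphic to any complement of U, hence finite-dimensional. *)
Fact vquot_vect_iso : Vector.axiom (\dim U^C) vquot.
Proof.
have dxU : (U^C :&: U = 0)%VS by rewrite capvC capv_compl.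
have piU x : x \in U -> daddv_pi U^C U x = 0.
  move=> xU; have := daddv_pi_add dxU (subvP (addvSr U^C U) x xU).
  have Ux : daddv_pi U U^C x = x by apply: daddv_pi_id; rewrite ?capv_compl.
  by rewrite Ux -[RHS]add0r => /addIr.
pose f (q : vquot) : 'rV[K]_(\dim U^C) :=
  \row_i coord (vbasis U^C) i (daddv_pi U^C U (vrepr q)).
have fpi x : f (vpi x) = \row_i coord (vbasis U^C) i (daddv_pi U^C U x).
  apply/rowP=> i; rewrite !mxE; congr (coord _ i _).
  have : vrepr (vpi x) - x \in U by rewrite -vpi_eq vreprK.
  by move/piU; rewrite linearB => /eqP; rewrite subr_eq0 => /eqP.
exists f.
  move=> a p q; rewrite -(vreprK p) -(vreprK q) -linearP !fpi.
  by apply/rowP=> i; rewrite !mxE !linearP.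
exists (fun r : 'rV_(\dim U^C) => vpi (\sum_i r 0 i *: (vbasis U^C)`_i)) => [q|r].
  rewrite -(vreprK q) fpi; apply/eqP; rewrite vpi_eq; set x := vrepr q.
  have -> : \sum_i (\row_i coord (vbasis U^C) i (daddv_pi U^C U x)) 0 i *:
      (vbasis U^C)`_i = daddv_pi U^C U x.
    rewrite [RHS](coord_vbasis (memv_pi _ _ _)).
    by apply: eq_bigr => i _; rewrite mxE.
  have xV : x \in (U^C + U)%VS by rewrite addvC addv_complf memvf.
  by rewrite -{2}(daddv_pi_add dxU xV) opprD addrA subrr sub0r rpredN memv_pi.
apply/rowP=> i; rewrite fpi mxE daddv_pi_id //.
  by rewrite coord_sum_free ?(basis_free (vbasisP _)).
by apply: rpred_sum => j _; rewrite rpredZ ?vbasis_mem ?memt_nth.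
Qed.
HB.instance Definition _ := Lmodule_hasFinDim.Build K vquot vquot_vect_iso.

End VQuot.

HB.mixin Record Vector_isLieAlgebra (K : fieldType) (g : Type)
    of Vector K g := {
  lie : g -> g -> g;
  lie_linearl : forall y, linear (lie ^~ y);
  lie_linearr : forall x, linear (lie x);
  liexx : forall x, lie x x = 0;
  lie_jacobi : forall x y z,
    lie x (lie y z) + lie y (lie z x) + lie z (lie x y) = 0
}.

#[short(type="lieAlgType")]
HB.structure Definition LieAlgebra (K : fieldType) :=
  { g of Vector_isLieAlgebra K g & Vector K g }.

Section LieTheory.
Variables (K : fieldType) (g : lieAlgType K).
Implicit Types (x y z : g) (U W : {vspace g}).

HB.instance Definition _ x :=
  GRing.isLinear.Build K g g _ (lie x) (lie_linearr x).

Definition liel y x := lie x y.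
Lemma lieEl x y : lie x y = liel y x. Proof. by []. Qed.
HB.instance Definition _ y :=
  GRing.isLinear.Build K g g _ (liel y) (lie_linearl y).

Lemma lieC x y : lie x y = - lie y x.
Proof.
have := liexx (x + y); rewrite linearD /= !lieEl !linearD /= -!lieEl !liexx.
by rewrite add0r addr0 addrC => /eqP; rewrite addr_eq0 => /eqP.
Qed.

Definition liev U W : {vspace g} :=
  (<<[seq lie u w | u <- vbasis U, w <- vbasis W]>>)%VS.

Lemma memv_lie U W u w : u \in U -> w \in W -> lie u w \in liev U W.
Proof.
move=> /coord_vbasis -> /coord_vbasis ->; rewrite linear_sum /=.
apply: rpred_sum => j _; rewrite linearZ /= rpredZ //.
rewrite lieEl linear_sum /=; apply: rpred_sum => i _.
rewrite linearZ /= rpredZ //; apply/memv_span/allpairsP.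
by exists ((vbasis U)`_i, (vbasis W)`_j); rewrite !mem_nth ?size_tuple.
Qed.

Lemma lievP U W (X : {vspace g}) :
  reflect {in U & W, forall u w, lie u w \in X} (liev U W <= X)%VS.
Proof.
apply: (iffP idP) => [/subvP sX u w uU wW | sX]; first exact/sX/memv_lie.
by apply/span_subvP=> _ /allpairsP[[u w] [/= uU wW ->]]; rewrite sX ?vbasis_mem.
Qed.

Fixpoint lcs (j : nat) : {vspace g} :=
  if j is j'.+1 then liev (lcs j') fullv else fullv.

Definition filiform (n : nat) : Prop :=
  [/\ \dim {:g} = n, lcs n.-1 = 0%VS & lcs n.-2 <> 0%VS].

(* Bilinear forms; the alternating ones are the elements of Hom(Lambda^2 g, K).*)
Definition bform := 'Hom(g, 'Hom(g, K^o)).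
Implicit Types w : bform.

Definition Z2 w : Prop :=
  (forall x, w x x = 0) /\
  (forall x y z, w (lie x y) z - w (lie x z) y + w (lie y z) x = 0).

Definition coboundary (f : 'Hom(g, K^o)) : bform :=
  linfun (fun x => f \o linfun (lie x))%VF.

Definition B2 : {vspace bform} := limg (linfun coboundary).

Fact coboundary_subproof (f : 'Hom(g, K^o)) :
  linear (fun x => f \o linfun (lie x))%VF.
Proof.
move=> a x y; apply/lfunP=> z.
rewrite add_lfunE scale_lfunE !comp_lfunE !lfunE /=.
by rewrite lieEl linearP /= linearP.
Qed.

Lemma coboundaryE f x y : coboundary f x y = f (lie x y).
Proof.
pose ll := GRing.isLinear.Build K g 'Hom(g, K^o) _ _ (coboundary_subproof f).
pose h : {linear g -> 'Hom(g, K^o)} := HB.pack (fun x => f \o linfun (lie x))%VF ll.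
by rewrite [coboundary f](_ : _ = linfun h) // !lfunE /= !lfunE.
Qed.

Fact coboundary_is_linear : linear coboundary.
Proof.
move=> a f h; apply/lfunP=> x; apply/lfunP=> y.
by rewrite !lfunE /= !lfunE /= !coboundaryE !lfunE /= !lfunE.
Qed.
HB.instance Definition _ :=
  GRing.isLinear.Build K 'Hom(g, K^o) bform _ coboundary coboundary_is_linear.

Lemma memB2 w :
  w \in B2 <-> exists f : 'Hom(g, K^o), forall x y, w x y = f (lie x y).
Proof.
split=> [/memv_imgP[f _ ->] | [f wE]].
  by exists f => x y; rewrite lfunE /= coboundaryE.
apply/memv_imgP; exists f; first exact: memvf.
by apply/lfunP=> x; apply/lfunP=> y; rewrite lfunE /= coboundaryE.
Qed.

Lemma sub_B2_Z2 w : w \in B2 -> Z2 w.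
Proof.
move=> /memB2[f wE]; split=> [x | x y z]; first by rewrite wE liexx linear0.
rewrite !wE -linearB -linearD.
have -> : lie (lie x y) z - lie (lie x z) y + lie (lie y z) x = 0.
  rewrite (lieC (lie x y)) (lieC (lie x z)) (lieC (lie y z)) (lieC x z).
  rewrite (linearN (lie y)) opprK /= -!opprD -[RHS]oppr0.
  rewrite -(lie_jacobi x y z); congr (- _).
  by rewrite addrC (addrC (lie z _)) addrA.
exact: linear0.
Qed.

(* Z2 / B2, as a subset of the quotient of the space of bilinear forms by B2. *)
Definition H2 (q : vquot B2) : Prop := exists2 w, Z2 w & q = vpi B2 w.

Definition H2_span (ws : seq bform) : Prop :=
  forall q : vquot B2, H2 q <-> q \in (<<map (vpi B2) ws>>)%VS.

Definition nondegenerate w : Prop :=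
  forall x, (forall y, w x y = 0) -> x = 0.

Definition symplectic : Prop := exists2 w, Z2 w & nondegenerate w.

Definition det_form n (e : n.-tuple g) w : K :=
  \det (\matrix_(i < n, j < n) w e`_i e`_j).

Definition wedge (f h : 'Hom(g, K^o)) : bform :=
  linfun (fun x => (f x : K) *: h - (h x : K) *: f : 'Hom(g, K^o)).

Lemma wedgeE f h x y : wedge f h x y = f x * h y - h x * f y.
Proof.
have lin : linear (fun x => (f x : K) *: h - (h x : K) *: f : 'Hom(g, K^o)).
  have dualP (p : 'Hom(g, K^o)) a u v : (p (a *: u + v) : K) = a * p u + p v.
    by rewrite linearP.
  move=> a u v; rewrite !dualP.
  by rewrite !scalerDl -!scalerA scalerBr opprD addrACA.
pose ll := GRing.isLinear.Build K g 'Hom(g, K^o) _ _ lin.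
pose F : {linear g -> 'Hom(g, K^o)} := HB.pack (fun x => (f x : K) *: h - (h x : K) *: f : 'Hom(g, K^o)) ll.
rewrite [wedge f h](_ : _ = linfun F) // lfunE /= add_lfunE opp_lfunE.
by rewrite !scale_lfunE.
Qed.
End LieTheory.

(* Indices start at 1: e_i is the entry of rank i - 1 of the tuple            *)
(* e, and alpha_{k,s} is alpha k s.                                           *)
Section Law14.
Variables (K : fieldType) (g : lieAlgType K).
Variables (e : 14.-tuple g) (alpha : nat -> nat -> K).

Definition bvec (i : nat) : g := e`_i.-1.

Definition bdual (i : nat) : 'Hom(g, K^o) :=
  linfun (fun x => coord e (inord i.-1) x : K^o).

Lemma bdualE i x : bdual i x = coord e (inord i.-1) x.
Proof.
have lin : linear (fun x => coord e (inord i.-1) x : K^o).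
  by move=> a u v; rewrite linearP.
pose ll := GRing.isLinear.Build K g K^o _ _ lin.
pose f : {linear g -> K^o} :=
  HB.pack (fun x => coord e (inord i.-1) x : K^o) ll.
by rewrite [bdual i](_ : _ = linfun f) // lfunE.
Qed.

Definition omega1 : bform g := wedge (bdual 2) (bdual 3).

Definition omega2 : bform g :=
  wedge (bdual 2) (bdual 5) - wedge (bdual 3) (bdual 4).

Definition I14 (k s : nat) : bool :=
  [&& (2 <= k <= 7)%N, (2 * k + 1 <= s)%N & (s <= 14)%N]
  || ((k == 7%N) && (s == 14%N)).

(* For r - j + i + 2l + 1 < 0 the truncated difference is 0, and then alpha   *)
(* is 0 as required, since (k, 0) is not in I14.                              *)
Definition law_coef (i j r : nat) : K :=
  \sum_(l < ((j - i - 1) %/ 2).+1)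
    (-1) ^+ l * 'C(j - i - l - 1, l)%:R
    * alpha (i + l) (r + i + 2 * l + 1 - j).

Definition A14 : Prop :=
  [/\ basis_of {:g} e,
      forall k s, ~~ I14 k s -> alpha k s = 0,
      forall i, (2 <= i <= 13)%N -> lie (bvec 1) (bvec i) = bvec i.+1,
      lie (bvec 1) (bvec 14) = 0
    & forall i j, (2 <= i)%N -> (i < j)%N -> (j <= 14)%N ->
        lie (bvec i) (bvec j) = \sum_(1 <= r < 15) law_coef i j r *: bvec r].

Definition propA : Prop :=
  ~ exists U : {vspace g}, [/\ (\dim U).+1 = \dim {:g},
      (lcs g 1 <= U)%VS & (liev U (lcs g 1) <= lcs g 4)%VS].

Definition propB : Prop := liev (lcs g 5) (lcs g 5) = 0%VS.

Definition propC : Prop := (liev (lcs g 1) (lcs g 1) <= lcs g 6)%VS.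

Definition A14_1 : Prop := [/\ A14, propA, propB & propC].
Definition A14_2 : Prop := [/\ A14, propA, propB & ~ propC].

(* dec [:: 1; 307; 611; 305] is 1307611305. Plain numerals of this size are   *)
(* unary and cannot be used.                                                  *)
Definition dec (s : seq nat) : K := foldl (fun a d => a * 1000 + d%:R) 0 s.

Definition P14 : K :=
  (dec [:: 1; 307; 611; 305])^-1 *
  (dec [:: 482; 832; 810; 500] * alpha 3 8 ^+ 3
   - dec [:: 157; 196; 008; 500] * alpha 3 8 ^+ 2 * alpha 2 6
   + dec [:: 2; 223; 828; 750] * alpha 3 8 * alpha 2 7
   + dec [:: 16; 180; 336; 845] * alpha 3 8 * alpha 2 6 ^+ 2
   + dec [:: 186; 801; 615] * alpha 2 8
   - dec [:: 266; 859; 450] * alpha 2 7 * alpha 2 6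
   - dec [:: 517; 476; 276] * alpha 2 6 ^+ 3).

Definition A14_21 : Prop := [/\ A14_2, alpha 2 5 = 1 & alpha 3 10 = P14].
Definition A14_22 : Prop := [/\ A14_2, alpha 2 5 = 1 & alpha 3 10 <> P14].

End Law14.

(* Main.v *)
Require Import Defs.
From mathcomp Require Import all_boot all_order all_algebra.
From mathcomp Require Import perm ring zify.
From Stdlib Require Import Classical.

Set Implicit Arguments.
Unset Strict Implicit.
Unset Printing Implicit Defensive.

Import GRing.Theory.
Local Open Scope ring_scope.

(** Kill the values [w(e_1, e_i)], [i < 14], of a 2-cocycle [w] by a coboundary
    and put [c = w(e_1, e_14)], [b_i = w(e_i, e_{i+1})].  The cocycle identity for
    a triple containing [e_1] determines all values of [w] from [c] and the [b_i]
    and makes [w(e_i, e_j)] vanish for [i + j > 15].  Coordinates of the bracket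
    are themselves cocycles (coboundaries of dual vectors), so the structure
    constants obey the same recursion and Jacobi identities and cocycle
    conditions are evaluated by the same expression.

    Give [alpha_{k,s}] the weight [s - 2k - 1].  In weight 0 the Jacobi
    identities leave two possibilities: all constants but [alpha_{2,5}] vanish,
    or they are those of the positive Witt algebra; [alpha_{3,7}], that is
    property (c), tells them apart.  The triples (2,3,10), (2,3,8), (2,3,6) and
    (2,3,4) determine [b_7], [b_6], [b_5], [b_4] in this order, so a cocycle with
    [c = 0] lies in the span of [omega_1], [omega_2] and the coboundaries.  Hence
    there is at most one further class, and without it [e_14] is in the radical
    of every cocycle.  In the first case [w(e_3, e_12) = 0], so
    [e_12, e_13, e_14] pair only with [e_1, e_2] and [w] is degenerate.  In the
    Witt case the triple (2,3,7) gives [c (alpha_{3,10} - P_14) = 0] up to a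
    nonzero factor; if [alpha_{3,10} = P_14] the remaining triples follow since
    the differential of [w] is annihilated by the Lie derivative along [e_1], and
    the antidiagonal of [w] has no zero. *)

(** * Structure constants and cocycle values by recursion *)

Section StructureConstants.
Variable K : fieldType.
Implicit Types (L W : nat -> nat -> K) (a : nat -> nat -> K) (b : nat -> K).

(* Values on [(e_i, e_{i+d})] of a form with [w(e_i, e_{i+1}) = b i] and
   [w(e_{i+1}, e_j) + w(e_i, e_{j+1}) = w(e_1, [e_i, e_j]) = L (j - i) i]. *)
Fixpoint spread L b (d i : nat) : K :=
  match d with
  | 0 => 0
  | 1 => b i
  | d'.+2 => L d'.+1 i - spread L b d' i.+1
  end.

(* The law with the vanishing constants, including [alpha_{7,14}], made to
   compute to 0 under [cbv]; hence the comparisons of the standard library. *)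
Definition trunc a k s : K :=
  if (Nat.leb 2 k && Nat.leb (Nat.add (Nat.add k k) 1) s
      && Nat.leb s (if Nat.leb 7 k then 13%N else 14%N))%bool
  then a k s else 0.

(* [strc a r d i] is the coordinate of [[e_i, e_{i+d}]] along [e_r]. *)
Fixpoint strc a (r : nat) : nat -> nat -> K :=
  match r with
  | 0 => fun _ _ => 0
  | r'.+1 => spread (strc a r') (fun i => trunc a i r)
  end.

(** The pair (e_i, e_{i+1}) with i >= 8 has index sum at least 17, where every cocycle vanishes
    ([form_eq0_17]). *)
Definition cut b i : K := if Nat.leb 8 i then 0 else b i.

(* A normalized cocycle with [w(e_1, e_14) = c] and [w(e_i, e_{i+1}) = b i]. *)
Definition ccoef a (c : K) b : nat -> nat -> K :=
  spread (fun d i => c * strc a 14 d i) (cut b).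

Definition skew W i j : K :=
  if Nat.ltb i j then W (Nat.sub j i) i else - W (Nat.sub i j) j.

(* The differential of the form with values [W] on [(e_i, e_j, e_k)]; for
   [W = strc a r] it is the [e_r]-coordinate of the Jacobi identity. *)
Definition dcoef a W i j k : K :=
  foldr (fun r x => strc a r (Nat.sub j i) i * skew W r k
      - strc a r (Nat.sub k i) i * skew W r j
      + strc a r (Nat.sub k j) j * skew W r i + x) 0 (iota 5 10).

Ltac expand_coefs := cbv beta iota zeta delta
  [dcoef ccoef cut strc spread skew trunc foldr iota Nat.sub Nat.add Nat.leb Nat.ltb andb].

Hypothesis char0 : [pchar K] =i pred0.

Lemma natr_neq0 n : (0 < n)%N -> n%:R != 0 :> K.
Proof. by move=> n0; rewrite ((pcharf0P _).1 char0) -lt0n. Qed.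

(** The shape of the eliminations below: a nonzero multiple of [x - y] is written as a combination
    of vanishing Jacobi expressions, and [ring] checks the identity. *)
Lemma eq_of_mulf_subr (c x y : K) : c != 0 -> c * (x - y) = 0 -> x = y.
Proof.
move=> n0 /eqP; rewrite mulf_eq0 (negbTE n0) /= subr_eq0.
by move/eqP.
Qed.

(** * Jacobi identities and cocycle conditions, weight by weight *)

Section Weights.
Variables (a : nat -> nat -> K) (b : nat -> K).

(** The e_r-coordinate of the Jacobi identity on (e_i, e_j, e_k) is homogeneous of weight r - i - j
    - k. Weights are nonnegative, so for r = i + j + k only constants of weight 0 occur. *)
Lemma weight0_eqs :
  let h := a 2 5 in let p := a 3 7 in let q := a 4 9 in let r := a 5 11 in
  let s := a 6 13 in
  [/\ dcoef a (strc a 9) 2 3 4 = 3 * p ^+ 2 - 2 * h * q - p * q,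
   dcoef a (strc a 11) 2 4 5 = 4 * p * q + p * r - 6 * q ^+ 2 + q * r - 2 * h * r,
   dcoef a (strc a 12) 3 4 5 = 4 * q ^+ 2 - 3 * p * r - 3 * q * r,
   dcoef a (strc a 13) 2 5 6 = 5 * p * r + 3 * p * s - 15 * q * r + 10 * r ^+ 2 - r * s - 2 * h * s
   & dcoef a (strc a 14) 3 5 6 = 5 * q * r + 2 * q * s - 3 * p * s - 10 * r ^+ 2 + 4 * r * s].
Proof. move=> /=; split; expand_coefs; ring. Qed.

Definition jacobi := forall i j k r, (1 < i)%N -> (i < j)%N -> (j < k)%N -> (k < 15)%N ->
  (0 < r < 15)%N -> dcoef a (strc a r) i j k = 0.

(* 4620 times the constants 1, 1/10, 1/70, 1/420, 1/2310 of the positive Witt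
   algebra. *)
Definition witt0 := [/\ a 2 5 = 4620, a 3 7 = 462, a 4 9 = 66, a 5 11 = 11 & a 6 13 = 2].

Definition flat0 := [/\ a 2 5 = 4620, a 3 7 = 0, a 4 9 = 0, a 5 11 = 0 & a 6 13 = 0].

(** For c = 0 the recursion gives w(e_p, e_q) = b_{(p+q-1)/2} up to sign if p + q is odd, and 0
    otherwise. A triple of index sum 2i + 1 thus involves only b_i, b_{i+1}, ..., and the
    coefficient of b_i has weight 0: the system is triangular. *)
Lemma cocycle_lead :
  [/\ dcoef a (ccoef a 0 b) 2 3 10
      = (2 * a 2 5 - 5 * a 3 7 + 5 * a 4 9 + 2 * a 5 11 - a 6 13) * b 7,
      b 7 = 0 -> dcoef a (ccoef a 0 b) 2 3 8 = (3 * a 3 7 - 2 * a 2 5 - a 5 11) * b 6,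
      b 7 = 0 -> b 6 = 0 -> dcoef a (ccoef a 0 b) 2 3 6 = (2 * a 2 5 - a 3 7 - a 4 9) * b 5
    & b 7 = 0 -> b 6 = 0 -> b 5 = 0 -> dcoef a (ccoef a 0 b) 2 3 4 = - (2 * a 2 5 + a 3 7) * b 4].
Proof.
split; expand_coefs; first ring.
- by move=> ->; ring.
- by move=> -> ->; ring.
- by move=> -> -> ->; ring.
Qed.

Lemma flat_weight0 : jacobi -> a 2 5 = 4620 -> a 3 7 = 0 -> flat0.
Proof.
move=> J h0 p0.
have [E1 E2 _ E4 _] := weight0_eqs.
have q0 : a 4 9 = 0.
  apply: (@eq_of_mulf_subr 9240%:R); first exact: natr_neq0.
  transitivity (- dcoef a (strc a 9) 2 3 4).
    by rewrite E1 h0 p0; ring.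
  by rewrite J ?oppr0.
have r0 : a 5 11 = 0.
  apply: (@eq_of_mulf_subr 9240%:R); first exact: natr_neq0.
  transitivity (- dcoef a (strc a 11) 2 4 5).
    by rewrite E2 h0 p0 q0; ring.
  by rewrite J ?oppr0.
split=> //; apply: (@eq_of_mulf_subr 9240%:R); first exact: natr_neq0.
transitivity (- dcoef a (strc a 13) 2 5 6); last by rewrite J ?oppr0.
by rewrite E4 h0 p0 q0 r0; ring.
Qed.

Lemma witt_weight0 : jacobi -> a 2 5 = 4620 -> a 3 7 <> 0 -> witt0.
Proof.
move=> J h0 p0.
have [E1 E2 E3 _ E5] := weight0_eqs.
have q0 : a 4 9 != 0.
  apply/eqP=> q0; case: p0; apply/eqP; rewrite -sqrf_eq0; apply/eqP.
  apply: (@eq_of_mulf_subr 3); first exact: natr_neq0.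
  transitivity (dcoef a (strc a 9) 2 3 4); last exact: J.
  by rewrite E1 q0; ring.
(* Eliminating [a 5 11] among the first three identities, with 9240 = 2 * [a 2 5], leaves 2 q^2 (p -
   7 q) = 0 for p = [a 3 7] and q = [a 4 9]. *)
have pE : a 3 7 = 7 * a 4 9.
  apply/eqP; rewrite -subr_eq0 -(mulrI_eq0 _ (mulfI q0)) -(mulrI_eq0 _ (mulfI q0)).
  apply/eqP; apply: (@eq_of_mulf_subr 2); first exact: natr_neq0.
  transitivity (- 9240 * dcoef a (strc a 12) 3 4 5
      + (a 3 7 + a 4 9) * (3 * dcoef a (strc a 11) 2 4 5 + dcoef a (strc a 12) 3 4 5)
      - 4 * a 4 9 * dcoef a (strc a 9) 2 3 4); last by rewrite !J //; ring.
  by rewrite E1 E2 E3 h0; ring.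
have qE : a 4 9 = 66.
  apply: (mulfI q0); apply: (@eq_of_mulf_subr 140); first exact: natr_neq0.
  transitivity (dcoef a (strc a 9) 2 3 4); last exact: J.
  by rewrite E1 h0 pE; ring.
have rE : a 5 11 = 11.
  apply: (@eq_of_mulf_subr 1584); first exact: natr_neq0.
  transitivity (- dcoef a (strc a 12) 3 4 5); last by rewrite J ?oppr0.
  by rewrite E3 pE qE; ring.
split=> //; first by rewrite pE qE; ring.
apply: (@eq_of_mulf_subr 1210); first exact: natr_neq0.
transitivity (- dcoef a (strc a 14) 3 5 6); last by rewrite J ?oppr0.
by rewrite E5 pE qE rE; ring.
Qed.

(* The weight 1 Jacobi identities have a plane of solutions; [m] and [n] are
   coordinates in a basis of its integral points. *)
Lemma witt_weight1 : jacobi -> witt0 -> exists m n,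
  [/\ a 2 6 = - 44880%:R * m - 382870%:R * n, a 3 8 = - 396 * m - 23781%:R * n,
      a 4 10 = 792 * m + 372 * n, a 5 12 = 275 * m + 725 * n
    & a 6 14 = 74 * m + 245 * n].
Proof.
move=> J [hE pE qE rE sE].
have e1 : - 3 * a 2 6 + 46 * a 3 8 - 147 * a 4 10 = 0.
  apply: (@eq_of_mulf_subr 66); first exact: natr_neq0.
  transitivity (dcoef a (strc a 10) 2 3 4); last exact: J.
  by expand_coefs; rewrite hE pE qE; ring.
have e2 : - 15 * a 2 6 + 250 * a 3 8 - 1000 * a 4 10 + 792 * a 5 12 = 0.
  apply: (@eq_of_mulf_subr 11); first exact: natr_neq0.
  transitivity (dcoef a (strc a 12) 2 3 6); last exact: J.
  by expand_coefs; rewrite hE pE qE rE; ring.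
have e3 : - 105 * a 2 6 + 2123 * a 3 8 - 12171%:R * a 4 10 + 23090%:R * a 5 12 - 7865%:R * a 6 14 = 0.
  transitivity (dcoef a (strc a 14) 2 3 8); last exact: J.
  by expand_coefs; rewrite hE pE qE rE sE; ring.
(* Cramer's rule for the claimed expressions of [a 4 10] and [a 5 12]; the determinant is 792 * 725
   - 372 * 275 = 300 * 1573, and a factor 11 cancels in [n]. *)
pose m := (725 * a 4 10 - 372 * a 5 12) / (300 * 1573).
pose n := (72 * a 5 12 - 25 * a 4 10) / (300 * 143).
have em : 300 * 1573 * m - 725 * a 4 10 + 372 * a 5 12 = 0.
  by rewrite /m mulrC divfK ?mulf_neq0 ?natr_neq0 //; ring.
have en : 300 * 143 * n - 72 * a 5 12 + 25 * a 4 10 = 0.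
  by rewrite /n mulrC divfK ?mulf_neq0 ?natr_neq0 //; ring.
(* The multipliers [x1], ..., [x5] certify that [y = z] is a linear consequence of the three Jacobi
   relations and the definitions of [m] and [n]. *)
have lin (x1 x2 x3 x4 x5 y z k : K) : k != 0 ->
    k * (y - z) = x1 * (- 3 * a 2 6 + 46 * a 3 8 - 147 * a 4 10)
      + x2 * (- 15 * a 2 6 + 250 * a 3 8 - 1000 * a 4 10 + 792 * a 5 12)
      + x3 * (- 105 * a 2 6 + 2123 * a 3 8 - 12171%:R * a 4 10 + 23090%:R * a 5 12 - 7865%:R * a 6 14)
      + x4 * (300 * 1573 * m - 725 * a 4 10 + 372 * a 5 12)
      + x5 * (300 * 143 * n - 72 * a 5 12 + 25 * a 4 10) ->
    y = z.
  by move=> k0; rewrite e1 e2 e3 em en !mulr0 !addr0; exact: eq_of_mulf_subr.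
clearbody m n; exists m, n; split.
- apply: (lin (- 17875%:R) 3289 0 408 38287%:R _ _ 4290); first by rewrite natr_neq0.
  by ring.
- apply: (lin (- 3575) 715 0 12 7927%:R _ _ (100 * 143)); first by rewrite mulf_neq0 ?natr_neq0.
  by ring.
- apply: (lin 0 0 0 (- 6) (- 31) _ _ 3575); first by rewrite natr_neq0.
  by ring.
- apply: (lin 0 0 0 (- 1) (- 29) _ _ 1716); first by rewrite natr_neq0.
  by ring.
- apply: (lin (- 5595%:R) 1539 (- 60) (- 74) (- 2695) _ _ (300 * 1573)); first by rewrite mulf_neq0 ?natr_neq0.
  by ring.
Qed.

(** On triples of index sum 15 only weight 0 enters, and both conditions are multiples of the same
    relation. Hence the parametrization c = 13 g, b_7 = 5 g used from here on. *)
Lemma witt_cocycle_w0 c : witt0 ->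
  dcoef a (ccoef a c b) 2 3 10 = 560 * (13 * b 7 - 5 * c) /\
  dcoef a (ccoef a c b) 2 5 8 = 549 * (13 * b 7 - 5 * c).
Proof. by move=> [hE pE qE rE sE]; split; expand_coefs; rewrite hE pE qE rE sE; ring. Qed.

(** [ccoef a c b 9 3] is w(e_3, e_12). The terms in c carry weight 0 constants with k >= 3, all zero
    here, so the recursion runs down to b_7 unchanged. *)
Lemma flat_cocycle_w0 c : flat0 ->
  dcoef a (ccoef a c b) 2 3 10 = 9240%:R * b 7 /\ ccoef a c b 9 3 = b 7.
Proof. by move=> [hE pE qE rE sE]; split; expand_coefs; rewrite ?hE pE qE rE sE; ring. Qed.

(** These are the values w(e_i, e_{15-i}) for i = 2, ..., 6; their nonvanishing for g = 1 yields a
    nonzero determinant. *)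
Lemma witt_antidiagonal g : witt0 -> b 7 = 5 * g ->
  [/\ ccoef a (13 * g) b 11 2 = 25410%:R * g, ccoef a (13 * g) b 9 3 = 1890 * g,
      ccoef a (13 * g) b 7 4 = 294 * g, ccoef a (13 * g) b 5 5 = 70 * g
    & ccoef a (13 * g) b 3 6 = 21 * g].
Proof.
by move=> [hE pE qE rE sE] b7; split; expand_coefs; rewrite b7 ?hE ?pE ?qE ?rE sE; ring.
Qed.

Section WittCocycles.
Variables (m n g : K).
Hypotheses (w0 : witt0) (b7 : b 7 = 5 * g).
Hypotheses (a26 : a 2 6 = - 44880%:R * m - 382870%:R * n)
  (a38 : a 3 8 = - 396 * m - 23781%:R * n) (a410 : a 4 10 = 792 * m + 372 * n)
  (a512 : a 5 12 = 275 * m + 725 * n) (a614 : a 6 14 = 74 * m + 245 * n).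

(** Index sum 14: no b_i other than b_7 can occur, and on the plane of solutions of the weight 1
    Jacobi identities the condition holds by itself. *)
Lemma witt_cocycle_w1 : dcoef a (ccoef a (13 * g) b) 2 3 9 = 0.
Proof.
have [hE pE qE rE sE] := w0.
expand_coefs; rewrite b7 hE pE qE rE sE a26 a38 a410 a512 a614.
ring.
Qed.

(** Jacobi identities are quadratic in the constants, so weight 2 gives a quadratic form in [m], [n]
    plus linear terms in the constants of weight 2. Likewise weight 3, treated next, is linear in
    weight 3 plus products of weights 1 and 2. *)
Lemma witt_jacobi_w2 :
  [/\ dcoef a (strc a 11) 2 3 4 = 108203040%:R * m ^+ 2 + 1092069000%:R * (m * n)
        + 2715966360%:R * n ^+ 2 - 242 * a 2 7 + 3311 * a 3 9 - 9702%:R * a 4 11,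
      dcoef a (strc a 13) 2 3 6 = 2 * (39182220%:R * m ^+ 2 + 395168400%:R * (m * n)
        + 981122130%:R * n ^+ 2 - 101 * a 2 7 + 1508 * a 3 9 - 5598%:R * a 4 11 + 4356 * a 5 13)
    & dcoef a (strc a 14) 2 3 7 = 6 * (8465160%:R * m ^+ 2 + 85217880%:R * (m * n)
        + 210833205%:R * n ^+ 2 - 27 * a 2 7 + 446 * a 3 9 - 2022 * a 4 11 + 2640 * a 5 13)].
Proof.
have [hE pE qE rE sE] := w0.
split; expand_coefs; rewrite hE pE qE rE ?sE a26 a38 a410 ?a512 ?a614; ring.
Qed.

Lemma witt_jacobi_w3 :
    dcoef a (strc a 12) 2 3 4 = - (2618 * a 2 7 * m + 38 * a 2 7 * n + 275 * a 2 8
      - 3542 * a 3 10 + 8041%:R * a 3 9 * m + 215536%:R * a 3 9 * n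
      - 135828%:R * a 4 11 * m - 1219953%:R * a 4 11 * n + 9702%:R * a 4 12)
 /\ dcoef a (strc a 14) 2 3 6 = - 2 * (833 * a 2 7 * m - 1186 * a 2 7 * n + 115 * a 2 8
      - 1620 * a 3 10 + 6376%:R * a 3 9 * m + 109663%:R * a 3 9 * n
      - 77664%:R * a 4 11 * m - 682467%:R * a 4 11 * n + 5682%:R * a 4 12
      + 68508%:R * a 5 13 * m + 551268%:R * a 5 13 * n - 4356 * a 5 14).
Proof.
have [hE pE qE rE sE] := w0.
split; expand_coefs; rewrite hE pE qE rE ?sE a26 a38 a410 ?a512 ?a614; ring.
Qed.

Lemma witt_cocycle_w23 :
    dcoef a (ccoef a (13 * g) b) 2 3 8 = - 5 * (1573 * b 6 - 81855774%:R * g * m ^+ 2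
      - 821294331%:R * g * m * n - 2020258032%:R * g * n ^+ 2 + 336 * a 2 7 * g
      - 6133%:R * a 3 9 * g + 32955%:R * a 4 11 * g - 60412%:R * a 5 13 * g)
 /\ dcoef a (ccoef a (13 * g) b) 2 3 7 = - (47190%:R * b 6 * n + 9282%:R * a 2 7 * g * m
      - 62166%:R * a 2 7 * g * n + 2405 * a 2 8 * g - 37560%:R * a 3 10 * g
      + 240084%:R * a 3 9 * g * m + 2931708%:R * a 3 9 * g * n
      - 2354118%:R * a 4 11 * g * m - 19600581%:R * a 4 11 * g * n + 161790%:R * a 4 12 * g
      + 3603600%:R * a 5 13 * g * m + 27458340%:R * a 5 13 * g * n - 205920%:R * a 5 14 * g).
Proof.
have [hE pE qE rE sE] := w0.
split; expand_coefs; rewrite b7 hE pE qE rE sE a26 a38 a410 a512 a614; ring.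
Qed.

(* The condition [alpha_{3,10} = P14] in the scaled constants, after elimination
   of [alpha_{2,6}] and [alpha_{3,8}] in favour of [m] and [n]. *)
Definition P14_scaled :=
   - 430610358816%:R * m ^+ 3 - 4175353012248%:R * m ^+ 2 * n
   - 10465588376760%:R * m * n ^+ 2 - 2234551459512%:R * n ^+ 3
   - 631620%:R * a 2 7 * m - 2805605%:R * a 2 7 * n - 49126%:R * a 2 8 + 343882%:R * a 3 10.

(** The triple (2,3,8) fixes b_6 in terms of g. After substitution into (2,3,7) only a multiple of g
    is left, whose other factor obstructs cocycles with c different from 0. *)
Lemma cocycle_obstruction : jacobi ->
  dcoef a (ccoef a (13 * g) b) 2 3 8 = 0 ->
  65219%:R * dcoef a (ccoef a (13 * g) b) 2 3 7 = - 5 * g * P14_scaled.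
Proof.
move=> J.
have [E1 E2 E3] := witt_jacobi_w2; have [E4 E5] := witt_jacobi_w3; have [E6 E7] := witt_cocycle_w23.
move=> T8.
(* Eliminates the constants of weight 2 and 3 with [k >= 4], [a 3 9] and [b 6]. *)
apply: (@eq_of_mulf_subr 6); first exact: natr_neq0.
transitivity (g * (61834806%:R * m + 525767332%:R * n) * dcoef a (strc a 11) 2 3 4
  - g * (123848340%:R * m + 1067048675%:R * n) * dcoef a (strc a 13) 2 3 6
  + g * (59098578%:R * m + 507557666%:R * n) * dcoef a (strc a 14) 2 3 7
  - 4308150%:R * g * dcoef a (strc a 12) 2 3 4
  + 9249240%:R * g * dcoef a (strc a 14) 2 3 6
  + 2347884%:R * n * dcoef a (ccoef a (13 * g) b) 2 3 8); last by rewrite !J // T8; ring.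
by rewrite E1 E2 E3 E4 E5 E6 E7 /P14_scaled; ring.
Qed.
End WittCocycles.

Variable alpha : nat -> nat -> K.

(** Multiplication by 4620^3 expresses each monomial in the scaled constants, those of degree below
    3 keeping powers of 4620; then [a 2 6] and [a 3 8] are replaced by [m] and [n]. *)
Lemma P14_scaledE m n : (forall k s, a k s = 4620 * alpha k s) ->
  a 2 6 = - 44880%:R * m - 382870%:R * n -> a 3 8 = - 396 * m - 23781%:R * n ->
  4620 ^+ 3 * (dec K [:: 1; 307; 611; 305]%N * alpha 3 10
   - (dec K [:: 482; 832; 810; 500]%N * alpha 3 8 ^+ 3
   - dec K [:: 157; 196; 008; 500]%N * alpha 3 8 ^+ 2 * alpha 2 6
   + dec K [:: 2; 223; 828; 750]%N * alpha 3 8 * alpha 2 7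
   + dec K [:: 16; 180; 336; 845]%N * alpha 3 8 * alpha 2 6 ^+ 2
   + dec K [:: 186; 801; 615]%N * alpha 2 8
   - dec K [:: 266; 859; 450]%N * alpha 2 7 * alpha 2 6
   - dec K [:: 517; 476; 276]%N * alpha 2 6 ^+ 3)) = 81162081000%:R * P14_scaled m n.
Proof.
move=> aE a26 a38.
transitivity (dec K [:: 1; 307; 611; 305]%N * 4620 ^+ 2 * a 3 10
   - (dec K [:: 482; 832; 810; 500]%N * a 3 8 ^+ 3
   - dec K [:: 157; 196; 008; 500]%N * a 3 8 ^+ 2 * a 2 6
   + dec K [:: 2; 223; 828; 750]%N * 4620 * a 3 8 * a 2 7
   + dec K [:: 16; 180; 336; 845]%N * a 3 8 * a 2 6 ^+ 2
   + dec K [:: 186; 801; 615]%N * 4620 ^+ 2 * a 2 8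
   - dec K [:: 266; 859; 450]%N * 4620 * a 2 7 * a 2 6
   - dec K [:: 517; 476; 276]%N * a 2 6 ^+ 3)).
  by rewrite !aE /dec /=; ring.
by cbv beta iota delta [dec foldl P14_scaled]; rewrite a26 a38; ring.
Qed.

Lemma P14_scaled_eq0 m n : (forall k s, a k s = 4620 * alpha k s) ->
  a 2 6 = - 44880%:R * m - 382870%:R * n -> a 3 8 = - 396 * m - 23781%:R * n ->
  (P14_scaled m n = 0) <-> (alpha 3 10 = P14 alpha).
Proof.
move=> aE a26 a38; have := P14_scaledE aE a26 a38; rewrite /P14.
set D := dec K [:: 1; 307; 611; 305]%N; set X := (X in D * _ - X) => eqP14.
(* Large numbers are split into small factors, so that [natr_neq0] is applied to small numerals
   only. *)
have D0 : D != 0.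
  have -> : D = 45 * 49 * (143 * 143) * 29 by rewrite /D /dec /=; ring.
  by rewrite !mulf_neq0 ?natr_neq0.
have S0 : 81162081000%:R != 0 :> K.
  have -> : 81162081000%:R = 1000 * (27 * 77) * (7 * 143) * (3 * 13) :> K by ring.
  by rewrite !mulf_neq0 ?natr_neq0.
have C0 : 4620 ^+ 3 != 0 :> K by rewrite expf_neq0 ?natr_neq0.
split=> [P0 | a310].
  apply: (mulfI D0); rewrite mulVKf //; apply/eqP; rewrite -subr_eq0.
  by rewrite -(mulrI_eq0 _ (mulfI C0)) eqP14 P0 mulr0.
by apply/eqP; rewrite -(mulrI_eq0 _ (mulfI S0)) -eqP14 a310 mulVKf // subrr mulr0.
Qed.

(** The conditions for (2,3,8), (2,3,6), (2,3,4) are affine in b_6, b_5, b_4 respectively, with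
    nonzero slopes, and are solved in this order. *)
Lemma witt_cocycle_exists : jacobi -> witt0 ->
  exists b', [/\ b' 7%N = 5, dcoef a (ccoef a 13 b') 2 3 8 = 0,
    dcoef a (ccoef a 13 b') 2 3 6 = 0 & dcoef a (ccoef a 13 b') 2 3 4 = 0].
Proof.
move=> J W; have [m [n [a26 a38 a410 a512 a614]]] := witt_weight1 J W.
have [hE pE qE rE sE] := W.
(* b_2 and b_3 are set to 0: they only change the form by multiples of the two omegas. *)
pose bb x4 x5 x6 := fun k : nat => match k with 7 => 5 | 6 => x6 | 5 => x5 | 4 => x4 | _ => 0 : K end.
pose T8 x6 := dcoef a (ccoef a 13 (bb 0 0 x6)) 2 3 8.
have T8E x4 x5 x6 : dcoef a (ccoef a 13 (bb x4 x5 x6)) 2 3 8 = T8 0 - 7865%:R * x6.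
  by rewrite /T8; expand_coefs; rewrite /bb hE pE qE rE sE; ring.
pose T6 x5 x6 := dcoef a (ccoef a 13 (bb 0 x5 x6)) 2 3 6.
have T6E x4 x5 x6 : dcoef a (ccoef a 13 (bb x4 x5 x6)) 2 3 6 = T6 0 x6 + 8712%:R * x5.
  by rewrite /T6; expand_coefs; rewrite /bb hE pE qE rE sE; ring.
have T4E x4 x5 x6 : dcoef a (ccoef a 13 (bb x4 x5 x6)) 2 3 4 =
    dcoef a (ccoef a 13 (bb 0 x5 x6)) 2 3 4 - 9702%:R * x4.
  by expand_coefs; rewrite /bb hE pE qE rE sE; ring.
pose x6 := T8 0 / 7865%:R; pose x5 := - T6 0 x6 / 8712%:R.
pose x4 := dcoef a (ccoef a 13 (bb 0 x5 x6)) 2 3 4 / 9702%:R.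
exists (bb x4 x5 x6); split=> //.
- by rewrite T8E /x6 mulrC divfK ?natr_neq0 // subrr.
- by rewrite T6E /x5 mulrC divfK ?natr_neq0 // subrr.
- by rewrite T4E /x4 mulrC divfK ?natr_neq0 // subrr.
Qed.

End Weights.

Lemma spread_scale l L L' b b' d i :
  (forall d i, L' d i = l * L d i) -> (forall i, b' i = l * b i) ->
  spread L' b' d i = l * spread L b d i.
Proof.
move=> LE bE; elim/ltn_ind: d i => -[|[|d]] IH i /=; rewrite ?mulr0 ?bE //.
by rewrite LE IH // mulrBr.
Qed.

(** Scaling the constants by [l] amounts to multiplying e_2, ..., e_14 by [l] and keeping e_1. *)
Lemma strc_scale l a r d i :
  strc (fun k s => l * a k s) r d i = l * strc a r d i.
Proof.
elim: r d i => [|r IH] d i /=; first by rewrite mulr0.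
by apply: spread_scale => // k; rewrite /trunc; case: ifP; rewrite ?mulr0.
Qed.

Lemma ccoef_scale l a c b d i :
  ccoef (fun k s => l * a k s) c (fun k => l * b k) d i = l * ccoef a c b d i.
Proof.
apply: spread_scale => [d' i'|k]; first by rewrite strc_scale mulrCA.
by rewrite /cut; case: ifP; rewrite ?mulr0.
Qed.

Lemma dcoef_scale l a W W' i j k : (forall d i, W' d i = l * W d i) ->
  dcoef (fun k s => l * a k s) W' i j k = l ^+ 2 * dcoef a W i j k.
Proof.
move=> WE; have sE p q : skew W' p q = l * skew W p q.
  by rewrite /skew; case: ifP; rewrite WE ?mulrN.
rewrite /dcoef; elim: (iota 5 10) => [|r s IH] /=; first by rewrite mulr0.
by rewrite IH !strc_scale !sE; ring.
Qed.
End StructureConstants.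

(** * Alternating forms on a Lie algebra and their differentials *)

Section LieForms.
Variables (K : fieldType) (g : lieAlgType K).
Implicit Types (x y z u v : g) (w : bform g).

Definition dform w x y z : K := w (lie x y) z - w (lie x z) y + w (lie y z) x.

Lemma bformDl w a x y z : w (a *: x + y) z = a * (w x z : K) + w y z :> K.
Proof. by rewrite linearP add_lfunE scale_lfunE. Qed.

Lemma bformDr w a x y z : w z (a *: x + y) = a * (w z x : K) + w z y :> K.
Proof. by rewrite linearP. Qed.

Lemma bformNl w x y : w (- x) y = - w x y.
Proof. by rewrite linearN opp_lfunE. Qed.

Lemma bform0l w y : w 0 y = 0.
Proof. by rewrite linear0 zero_lfunE. Qed.

Lemma alt_skew w : (forall x, w x x = 0) -> forall x y, w y x = - w x y :> K.
Proof.
move=> w0 x y; have := w0 (1 *: x + y); rewrite bformDl !bformDr !w0 !mul1r.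
rewrite add0r addr0 => /eqP; rewrite addrC addr_eq0 => /eqP //.
Qed.

Lemma Z2_alt w : Z2 w -> forall x y, w y x = - w x y :> K.
Proof. by case=> w0 _; exact: alt_skew. Qed.

Lemma Z2_dform w : Z2 w -> forall x y z, dform w x y z = 0.
Proof. by case. Qed.

Lemma lieDl a x y z : lie (a *: x + y) z = a *: lie x z + lie y z.
Proof. by rewrite lieEl linearP. Qed.

Lemma lieDr a x y z : lie z (a *: x + y) = a *: lie z x + lie z y.
Proof. by rewrite linearP. Qed.

Lemma dformP1 w a x x' y z : dform w (a *: x + x') y z = a * dform w x y z + dform w x' y z.
Proof. by rewrite /dform !lieDl !bformDl bformDr; ring. Qed.

Lemma dformP2 w a x x' y z : dform w y (a *: x + x') z = a * dform w y x z + dform w y x' z.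
Proof. by rewrite /dform !lieDr !lieDl !bformDl !bformDr; ring. Qed.

Lemma dformP3 w a x x' y z : dform w y z (a *: x + x') = a * dform w y z x + dform w y z x'.
Proof. by rewrite /dform !lieDr !bformDl !bformDr; ring. Qed.

Lemma dform_swap12 w x y z : (forall x, w x x = 0) -> dform w y x z = - dform w x y z.
Proof. by move=> w0; rewrite /dform (lieC y x) bformNl; ring. Qed.

Lemma dform_swap23 w x y z : (forall x, w x x = 0) -> dform w x z y = - dform w x y z.
Proof. by move=> w0; rewrite /dform (lieC z y) bformNl; ring. Qed.

Lemma dform_xx w x y : (forall x, w x x = 0) -> dform w x x y = 0.
Proof. by move=> w0; rewrite /dform liexx bform0l; ring. Qed.

(* The Lie derivative of [dw] along [d] is the differential of [i_d dw], since
   [dw] is closed. *)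
Lemma dform_derive w d x y z : (forall x, w x x = 0) -> (forall x y, dform w d x y = 0) ->
  dform w (lie d x) y z + dform w x (lie d y) z + dform w x y (lie d z) = 0.
Proof.
move=> w0 wd.
have wdE u v : w (lie d u) v = w (lie d v) u - w (lie u v) d :> K.
  by have := wd u v; rewrite /dform => e; rewrite -[RHS]addr0 -{1}e; ring.
have jac u v : lie d (lie u v) = lie (lie d u) v + lie u (lie d v).
  have := lie_jacobi d u v; rewrite (lieC v d) (linearN (lie u)) /= (lieC v (lie d u)).
  by move/eqP; rewrite -addrA -opprD subr_eq0 addrC => /eqP.
have eq u v t : w (lie (lie d u) v) t + w (lie u (lie d v)) t - w (lie d t) (lie u v)
   = - w (lie (lie u v) t) d :> K.
  transitivity (w (lie d (lie u v)) t - w (lie d t) (lie u v) : K).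
    by rewrite jac linearD add_lfunE.
  by rewrite wdE; ring.
have sk := alt_skew w0; rewrite /dform.
have -> : w (lie y z) (lie d x) = - w (lie d x) (lie y z) :> K by exact: sk.
have -> : w (lie x z) (lie d y) = - w (lie d y) (lie x z) :> K by exact: sk.
have -> : w (lie x y) (lie d z) = - w (lie d z) (lie x y) :> K by exact: sk.
transitivity (- (w (lie (lie x y) z) d - w (lie (lie x z) y) d + w (lie (lie y z) x) d) : K).
  transitivity ((w (lie (lie d x) y) z + w (lie x (lie d y)) z - w (lie d z) (lie x y))
    - (w (lie (lie d x) z) y + w (lie x (lie d z)) y - w (lie d y) (lie x z))
    + (w (lie (lie d y) z) x + w (lie y (lie d z)) x - w (lie d x) (lie y z)) : K).
    by ring.
  by rewrite !eq; ring.
have -> : lie (lie x y) z = lie (lie x z) y - lie (lie y z) x.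
  have := lie_jacobi x y z; rewrite (lieC z (lie x y)) (lieC y (lie z x)) (lieC x (lie y z)).
  rewrite (lieC z x) (lieEl (- _)) linearN /= opprK -lieEl => /eqP.
  by rewrite subr_eq0 addrC => /eqP <-.
by rewrite linearB add_lfunE opp_lfunE; ring.
Qed.

Lemma Z2_linear a w w' : Z2 w -> Z2 w' -> Z2 (a *: w + w').
Proof.
move=> [w0 wd] [w0' wd']; split=> [x | x y z].
  by rewrite add_lfunE scale_lfunE add_lfunE scale_lfunE w0 w0' scaler0 addr0.
rewrite !(add_lfunE, scale_lfunE).
transitivity (a * dform w x y z + dform w' x y z); first by rewrite /dform /GRing.scale /=; ring.
by rewrite /dform wd wd' mulr0 addr0.
Qed.

Lemma Z2_0 : Z2 (0 : bform g).
Proof. by split=> *; rewrite !zero_lfunE ?subrr ?add0r. Qed.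

Lemma Z2_span (ws : seq (bform g)) :
  (forall w, w \in ws -> Z2 w) -> forall w, w \in <<ws>>%VS -> Z2 w.
Proof.
move=> wsZ w /(@coord_span _ _ _ (in_tuple ws)) ->.
apply: (big_ind (fun w => Z2 w)) => [|u v Zu Zv|i _]; first exact: Z2_0.
  by rewrite -[u]scale1r; exact: Z2_linear.
by rewrite -[_ *: _]addr0; apply: Z2_linear Z2_0; apply/wsZ/mem_nth.
Qed.

Lemma H2_spanP (ws : seq (bform g)) : (forall w, w \in ws -> Z2 w) ->
  (forall w, Z2 w -> exists2 u, u \in <<ws>>%VS & w - u \in B2 g) -> H2_span ws.
Proof.
move=> wsZ ws_gen q.
have mapE : [seq vpi (B2 g) i | i <- ws] = [seq linfun (vpi (B2 g)) i | i <- ws].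
  by apply: eq_map => u; rewrite lfunE.
rewrite mapE -limg_span; split=> [[w Zw ->] | /memv_imgP[u uws ->]].
  have [u uws] := ws_gen w Zw; rewrite -vpi_eq => /eqP ->.
  by rewrite -[vpi _ u]/((vpi (B2 g) : {linear _ -> _}) u) -(lfunE (vpi (B2 g))) memv_img.
by exists u; [exact: Z2_span wsZ _ uws | rewrite lfunE].
Qed.
End LieForms.

(** * Forms, differentials and determinants in a basis *)

Section Basis.
Variables (K : fieldType) (g : lieAlgType K) (e : 14.-tuple g).
Hypothesis e_basis : basis_of {:g} e.
Implicit Types (x y z : g) (w : bform g).
Local Notation v i := (bvec e i).
Local Notation xi i := (bdual e i).

Lemma bdual_bvec i j : (0 < i < 15)%N -> (0 < j < 15)%N -> xi i (v j) = (i == j)%:R :> K.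
Proof.
case: i j => [|i] [|j] // /andP[_ hi] /andP[_ hj]; rewrite bdualE /bvec /=.
have := coord_free (inord j) (inord i) (basis_free e_basis).
by rewrite inordK // => ->; rewrite -val_eqE /= !inordK // eq_sym.
Qed.

Lemma bvec_out i : (14 < i)%N -> v i = 0.
Proof. by move=> hi; rewrite /bvec nth_default // size_tuple; case: i hi. Qed.

Lemma bvec_expand x : x = \sum_(1 <= i < 15) (xi i x : K) *: v i.
Proof.
rewrite {1}(coord_basis e_basis (memvf x)) big_add1 big_mkord.
by apply: eq_bigr => i _; rewrite bdualE /bvec /= inord_val.
Qed.

Lemma linear_zero (f : g -> K) : (forall a x y, f (a *: x + y) = a * f x + f y) ->
  (forall i, (0 < i < 15)%N -> f (v i) = 0) -> forall x, f x = 0.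
Proof.
move=> fP f0 x; rewrite (bvec_expand x) big_nat.
have f00 : f 0 = 0 by have := fP (- 1) 0 0; rewrite scaler0 addr0 mulN1r addNr.
apply: (big_ind (fun u => f u = 0)) => [//|u u' fu fu'|i hi].
  by rewrite -[u]scale1r fP fu fu' mulr0 addr0.
by rewrite -[_ *: _]addr0 fP f0 // f00 mulr0 addr0.
Qed.

Lemma bform_zero w : (forall x, w x x = 0) ->
  (forall i j, (0 < i)%N -> (i < j < 15)%N -> w (v i) (v j) = 0) -> w = 0.
Proof.
move=> w0 wv; apply/lfunP=> x; apply/lfunP=> y; rewrite !zero_lfunE.
apply: (linear_zero (f := fun x => w x y)) x => [a x x'|i hi]; first exact: bformDl.
apply: (linear_zero (f := fun y => w (v i) y)) y => [a y y'|j hj]; first exact: bformDr.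
have [ij|ij|->] := ltngtP i j; last exact: w0.
  by rewrite wv //; lia.
by rewrite (alt_skew w0) wv ?oppr0 //; lia.
Qed.

Lemma dform_zero w : (forall x, w x x = 0) ->
  (forall i j k, (0 < i)%N -> (i < j)%N -> (j < k < 15)%N -> dform w (v i) (v j) (v k) = 0) ->
  forall x y z, dform w x y z = 0.
Proof.
move=> w0 wv.
have le2 i j k : (0 < i)%N -> (i < j < 15)%N -> (0 < k < 15)%N ->
    dform w (v i) (v j) (v k) = 0.
  move=> hi hj hk; have [ik|ik|->] := ltngtP i k; last first.
  - by rewrite dform_swap23 // dform_xx ?oppr0.
  - by rewrite dform_swap23 // dform_swap12 // wv ?oppr0 //; lia.
  have [jk|jk|->] := ltngtP j k; last first.
  - by rewrite dform_swap12 // dform_swap23 // dform_xx ?oppr0.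
  - by rewrite dform_swap23 // wv ?oppr0 //; lia.
  by rewrite wv //; lia.
move=> x y z.
apply: (linear_zero (f := fun x => dform w x y z)) x => [a x x'|i hi]; first exact: dformP1.
apply: (linear_zero (f := fun y => dform w (v i) y z)) y => [a y y'|j hj]; first exact: dformP2.
apply: (linear_zero (f := fun z => dform w (v i) (v j) z)) z => [a z z'|k hk].
  exact: dformP3.
have [ij|ij|->] := ltngtP i j; last exact: dform_xx.
  by rewrite le2 //; lia.
by rewrite dform_swap12 // le2 ?oppr0 //; lia.
Qed.

Lemma wedge_alt (f h : 'Hom(g, K^o)) x : wedge f h x x = 0.
Proof. by rewrite wedgeE mulrC subrr. Qed.

Definition form_of (A : nat -> nat -> K) : bform g :=
  \sum_(i < 14) \sum_(j < 14 | (i < j)%N) A i.+1 j.+1 *: wedge (xi i.+1) (xi j.+1).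

Lemma form_ofE A x y : form_of A x y =
  \sum_(i < 14) \sum_(j < 14 | (i < j)%N)
     A i.+1 j.+1 * (xi i.+1 x * xi j.+1 y - xi j.+1 x * xi i.+1 y) :> K.
Proof.
rewrite !sum_lfunE; apply: eq_bigr => i _; rewrite !sum_lfunE.
by apply: eq_bigr => j _; rewrite !scale_lfunE wedgeE.
Qed.

Lemma form_of_alt A x : form_of A x x = 0.
Proof.
by rewrite form_ofE big1 // => i _; rewrite big1 // => j _; rewrite mulrC [X in _ - X]mulrC subrr mul0r.
Qed.

Lemma form_of_bvec A i j : (0 < i)%N -> (i < j < 15)%N -> form_of A (v i) (v j) = A i j.
Proof.
case: i j => [|i] [|j] // _ /andP[ij hj]; have hi : (i < 14)%N by lia.
have od (p : 'I_14) : (0 < p.+1 < 15)%N := ltn_ord p.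
rewrite form_ofE (bigD1 (Ordinal hi)) //= [X in _ + X]big1 => [|p /eqP pi]; last first.
  rewrite big1 // => q pq; rewrite !bdual_bvec ?od // ?eqSS.
  have -> : (p == i :> nat) = false by apply/eqP=> E; apply: pi; apply: val_inj.
  have [/eqP|] := eqVneq (p : nat) j; last by rewrite !(mul0r, mulr0) subrr mulr0.
  move=> /eqP pj; have -> : (q == i :> nat) = false by lia.
  by rewrite !(mul0r, mulr0) subrr mulr0.
rewrite addr0 (bigD1 (Ordinal (hj : (j < 14)%N))) //= big1 => [|q /andP[iq /eqP qj]].
  rewrite !bdual_bvec ?od // !eqxx eqSS; have -> : (j == i) = false by lia.
  by rewrite addr0 mul0r subr0 !mulr1.
rewrite !bdual_bvec ?od // !eqSS.
have -> : (q == j :> nat) = false by apply/eqP=> E; apply: qj; apply: val_inj.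
have -> : (q == i :> nat) = false by lia.
by rewrite !(mul0r, mulr0) subrr mulr0.
Qed.

(** Reversing the rows makes the Gram matrix lower triangular, with the antidiagonal of [w] as its
    diagonal. *)
Lemma det_form_neq0 w :
  (forall i j, (0 < i < 15)%N -> (0 < j < 15)%N -> (15 < i + j)%N -> w (v i) (v j) = 0) ->
  (forall i, (0 < i < 15)%N -> w (v i) (v (15 - i)) <> 0) -> det_form e w <> 0.
Proof.
move=> w0 wd; rewrite /det_form; set M := \matrix_(_, _) _.
pose s : {perm 'I_14} := perm (@rev_ord_inj 14).
have sM : is_trig_mx (row_perm s M).
  apply/is_trig_mxP=> i j ij; rewrite !mxE permE /=.
  by apply: (w0 (14 - i.+1).+1 j.+1); have := ltn_ord i; have := ltn_ord j; lia.
move=> detM; have : \det (row_perm s M) = 0 by rewrite row_permE det_mulmx detM mulr0.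
rewrite det_trig // => /eqP; rewrite prodf_seq_eq0 => /hasP[i _] /=.
rewrite !mxE permE /= => /eqP; have hi := ltn_ord i.
have := wd (14 - i.+1).+1; have -> : (15 - (14 - i.+1).+1 = i.+1)%N by lia.
by apply; lia.
Qed.

Lemma det_form_nondegenerate w : (forall x, w x x = 0) -> det_form e w <> 0 -> Defs.nondegenerate w.
Proof.
move=> w0 detw x xw; pose r : 'rV[K]_14 := \row_i coord e i x.
have r0 : r *m (\matrix_(i < 14, j < 14) (w e`_i e`_j : K)) = 0.
  apply/rowP=> j; rewrite !mxE -[RHS](xw e`_j) [in RHS](coord_basis e_basis (memvf x)).
  rewrite linear_sum sum_lfunE; apply: eq_bigr => i _.
  by rewrite !mxE linearZ scale_lfunE.
have Mu : \matrix_(i < 14, j < 14) (w e`_i e`_j : K) \in unitmx.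
  by rewrite unitmxE unitfE; apply/eqP.
have rE : r = 0 by rewrite -[r](mulmxK Mu) r0 mul0mx.
rewrite (coord_basis e_basis (memvf x)) big1 // => i _.
by have /rowP/(_ i) := rE; rewrite !mxE => ->; rewrite scale0r.
Qed.
End Basis.

(** * Vanishing for reasons of index sum *)

Lemma spread_small (K : fieldType) (L : nat -> nat -> K) b N d i :
  (forall d i, (1 < i)%N -> (N <= i.*2 + d)%N -> L d i = 0) ->
  (forall i, (1 < i)%N -> (N < i.*2 + 1)%N -> b i = 0) ->
  (1 < i)%N -> (N < i.*2 + d)%N -> spread L b d i = 0.
Proof.
move=> L0 b0; elim/ltn_ind: d i => -[|[|d]] IHd i hi hr //=; first exact: b0.
(* [L d.+1 i] belongs to a pair of index sum one less than the value computed, hence the weak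
   inequality assumed for [L]. *)
by rewrite L0 ?IHd ?subrr //; lia.
Qed.

(** In terms of the algebra, [e_i, e_j] lies in the span of the e_r with r >= i + j. The only
    constant of negative weight, alpha_{7,14}, is removed by [trunc]. *)
Lemma strc_small (K : fieldType) (a : nat -> nat -> K) r d i :
  (1 < i)%N -> (r < i.*2 + d)%N -> strc a r d i = 0.
Proof.
elim: r d i => // r IHr d i hi hr; apply: (spread_small (N := r.+1)) => // j hj rj.
by rewrite /trunc; case: ifP => // /andP[/andP[_]]; lia.
Qed.

Lemma ccoef_small (K : fieldType) (a : nat -> nat -> K) c b d i :
  (1 < i)%N -> (15 < i.*2 + d)%N -> ccoef a c b d i = 0.
Proof.
apply: spread_small => [d' j hj hd|j _ hj]; first by rewrite strc_small ?mulr0.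
by rewrite /cut; case: ifP => // j8; lia.
Qed.

(** * The brackets of the adapted basis follow the recursion *)

Section Law.
Variables (K : fieldType) (g : lieAlgType K) (e : 14.-tuple g) (alpha : nat -> nat -> K).
Hypotheses (law : A14 e alpha) (alpha714 : alpha 7 14 = 0).
Implicit Types (x y z : g) (w : bform g).
Local Notation v i := (bvec e i).
Local Notation xi i := (bdual e i).

Let e_basis : basis_of {:g} e. Proof. by case: law. Qed.

Lemma lie1_bvec i : (1 < i < 15)%N -> lie (v 1) (v i) = v i.+1.
Proof.
case: law => _ _ lie1 lie114 _ hi; have [->|i14] := eqVneq i 14%N.
  by rewrite lie114 bvec_out.
by apply: lie1; lia.
Qed.

Lemma trunc_law k s : (1 < k)%N -> trunc alpha k s = alpha k s.
Proof.
case: law => _ alpha0 _ _ _ hk; rewrite /trunc; case k7: (Nat.leb 7 k); case: ifP => // nI;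
have [[-> ->] //|nE] : (k = 7 /\ s = 14 \/ ~ (k = 7 /\ s = 14))%N by lia.
  by rewrite alpha0 //; apply/negP => /orP[/and3P[]|/andP[/eqP ? /eqP ?]]; lia.
by rewrite alpha0 //; apply/negP => /orP[/and3P[]|/andP[/eqP ? /eqP ?]]; lia.
Qed.

Lemma spread_form w (L : nat -> nat -> K) b : Z2 w ->
  (forall d i, (1 < i)%N -> (i + d < 15)%N -> w (v 1) (lie (v i) (v (i + d))) = L d i :> K) ->
  (forall i, (1 < i < 14)%N -> w (v i) (v i.+1) = b i :> K) ->
  forall d i, (1 < i)%N -> (i + d < 15)%N -> w (v i) (v (i + d)) = spread L b d i :> K.
Proof.
move=> Zw wL wb; elim/ltn_ind => -[|[|d]] IH i hi hd /=.
- by rewrite addn0; case: Zw.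
- by rewrite addn1 wb //; lia.
have := Z2_dform Zw (v 1) (v i) (v (i + d.+1)).
rewrite /dform !lie1_bvec; [|lia..].
have -> : w (v (i + d.+1).+1) (v i) = - w (v i) (v (i + d.+2)) :> K.
  by rewrite -(Z2_alt Zw) (addnS i d.+1).
have -> : w (lie (v i) (v (i + d.+1))) (v 1) = - L d.+1 i :> K.
  by rewrite -wL ?(Z2_alt Zw (v 1)) //; lia.
have -> : w (v i.+1) (v (i + d.+1)) = spread L b d i.+1 :> K.
  by rewrite -IH -?addSnnS //; lia.
have solve (p q r : K) : r - - p - q = 0 -> p = q - r.
  by move=> E; rewrite -[RHS]addr0 -E; ring.
exact: solve.
Qed.

Lemma dual_linear (f : 'Hom(g, K^o)) a x y : f (a *: x + y) = a * (f x : K) + f y :> K.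
Proof. by rewrite linearP. Qed.

Lemma bdual_lie1 r x : (1 < r < 14)%N -> xi r.+1 (lie (v 1) x) = xi r x :> K.
Proof.
move=> hr; apply/eqP; rewrite -subr_eq0; apply/eqP.
apply: (linear_zero e_basis (f := fun x => (xi r.+1 (lie (v 1) x) : K) - xi r x)) x => [a x y|i hi].
  by rewrite lieDr !dual_linear; ring.
have [->|i1] := eqVneq i 1%N.
  by rewrite liexx linear0 bdual_bvec //; [rewrite (_ : r == 1 = false)%N ?subrr //; lia | lia].
rewrite lie1_bvec; last by lia.
have [i14|i14] := ltnP i 14.
  by rewrite !bdual_bvec //; [rewrite eqSS subrr | lia..].
rewrite bvec_out // linear0 bdual_bvec //; last by lia.
by rewrite (_ : r == i = false) ?subrr //; lia.
Qed.

Lemma bdual_lie1_small r x : (0 < r < 3)%N -> xi r (lie (v 1) x) = 0 :> K.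
Proof.
move=> hr; apply: (linear_zero e_basis (f := fun x => xi r (lie (v 1) x) : K)) x => [a x y|i hi].
  by rewrite lieDr dual_linear.
have [->|i1] := eqVneq i 1%N; first by rewrite liexx linear0.
rewrite lie1_bvec; last by lia.
have [i14|i14] := ltnP i 14; last by rewrite bvec_out // linear0.
by rewrite bdual_bvec; [rewrite (_ : r == i.+1 = false) //; lia | lia..].
Qed.

Lemma Z2_coboundary (f : 'Hom(g, K^o)) : Z2 (coboundary f).
Proof. by apply/sub_B2_Z2/memB2; exists f => x y; rewrite coboundaryE. Qed.

Lemma bdual_lie_succ i r : (1 < i < 14)%N -> (0 < r < 15)%N ->
  xi r (lie (v i) (v i.+1)) = alpha i r :> K.
Proof.
case: law => _ _ _ _ lieE hi hr; rewrite lieE; try lia.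
rewrite linear_sum (bigD1_seq r) ?iota_uniq ?mem_index_iota //=.
rewrite linearZ /= bdual_bvec // eqxx big_nat_cond big1 ?addr0 => [|s]; last first.
  move=> /andP[hs sr]; rewrite linearZ /= bdual_bvec // eq_sym (negbTE sr).
  exact: mulr0.
rewrite /law_coef (_ : (i.+1 - i - 1) %/ 2 = 0)%N; last by lia.
rewrite big_ord1 /= addn0 (_ : (r + i + 2 * 0 + 1 - i.+1 = r)%N); last by lia.
by rewrite bin0 /GRing.scale /= expr0 !mulr1 mul1r.
Qed.

(** Induction on [r], applied to the coboundary of [xi r]: since ad e_1 is a shift, its values on
    (e_1, [e_i, e_j]) are coordinates of [e_i, e_j] along e_{r-1}. The binomial formula of the law
    is needed only for j = i + 1. *)
Lemma bdual_lie r d i : (1 < i)%N -> (i + d < 15)%N -> (0 < r < 15)%N ->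
  xi r (lie (v i) (v (i + d))) = strc alpha r d i :> K.
Proof.
elim: r d i => // r IH d i hi hd hr; rewrite -coboundaryE.
apply: spread_form => // [|d' i' hi' hd'|i' hi']; first exact: Z2_coboundary.
  rewrite coboundaryE; case: r IH hr => [|[|r]] IH hr.
  - by rewrite bdual_lie1_small.
  - by rewrite bdual_lie1_small // -[spread _ _ _ _]/(strc alpha 1 d' i') strc_small //; lia.
  - by rewrite bdual_lie1 ?IH //; lia.
by rewrite coboundaryE bdual_lie_succ ?trunc_law //; lia.
Qed.

Lemma skew_form w W : (forall x, w x x = 0) ->
  (forall d i, (1 < i)%N -> (i + d < 15)%N -> w (v i) (v (i + d)) = W d i :> K) ->
  forall i j, (1 < i < 15)%N -> (1 < j < 15)%N -> w (v i) (v j) = skew W i j :> K.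
Proof.
move=> w0 wW i j hi hj; rewrite /skew; case: ifP => ij.
  rewrite -wW; [|lia..]; congr (w _ (v _)); lia.
rewrite -wW; [|lia..]; rewrite (alt_skew w0); congr (- w _ (v _)); lia.
Qed.

Lemma dform_dcoef w W : (forall x, w x x = 0) ->
  (forall d i, (1 < i)%N -> (i + d < 15)%N -> w (v i) (v (i + d)) = W d i :> K) ->
  forall i j k, (1 < i)%N -> (i < j)%N -> (j < k < 15)%N ->
  dform w (v i) (v j) (v k) = dcoef alpha W i j k.
Proof.
move=> w0 wW i j k hi ij jk.
have lieE p q t : (1 < p)%N -> (p < q < 15)%N -> (1 < t < 15)%N ->
    w (lie (v p) (v q)) (v t) =
    \sum_(r <- iota 5 10) strc alpha r (Nat.sub q p) p * skew W r t :> K.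
  move=> hp hq ht; rewrite (bvec_expand e_basis (lie _ _)) linear_sum sum_lfunE.
  (* A bracket of two vectors of index at least 2 has no coordinate below 5, which explains the
     range in [dcoef]. *)
  rewrite (@big_cat_nat _ _ _ 5) //= big_nat_cond big1 ?add0r => [|r hr].
    rewrite /index_iota; apply: eq_big_seq => r; rewrite mem_iota => hr.
    rewrite linearZ scale_lfunE /=; rewrite {1}(_ : q = p + Nat.sub q p)%N; last by lia.
    by rewrite bdual_lie ?(skew_form w0 wW) //; lia.
  rewrite linearZ scale_lfunE /=; rewrite {1}(_ : q = p + Nat.sub q p)%N; last by lia.
  by rewrite bdual_lie ?strc_small ?scale0r //; lia.
rewrite /dform !lieE; [|lia..].
rewrite /dcoef -sumrB -big_split; elim: (iota 5 10) => [|r s IH] /=.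
  by rewrite big_nil.
by rewrite big_cons IH.
Qed.

Lemma jacobi_law : jacobi alpha.
Proof.
move=> i j k r hi ij jk hk hr; rewrite -(dform_dcoef (w := coboundary (xi r))) //.
- exact/Z2_dform/Z2_coboundary.
- by case: (Z2_coboundary (xi r)).
- by move=> d p hp hd; rewrite coboundaryE bdual_lie.
- by rewrite jk.
Qed.
End Law.

(** Up to sign the leading coefficients are 9240 throughout in the flat case, and 7280, 7865, 8712,
    9702 in the Witt case. *)
Lemma cocycle_lead_eq0 (K : fieldType) (char0 : [pchar K] =i pred0)
    (a : nat -> nat -> K) b : flat0 a \/ witt0 a ->
  (forall i j k, (1 < i)%N -> (i < j)%N -> (j < k < 15)%N ->
     dcoef a (ccoef a 0 b) i j k = 0) ->
  [/\ b 7%N = 0, b 6%N = 0, b 5%N = 0 & b 4%N = 0].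
Proof.
move=> a0 T; have [E7 E6 E5 E4] := cocycle_lead a b.
have scaled n (y z : K) : z = 0 -> z = n.+1%:R * y \/ z = - n.+1%:R * y -> y = 0.
  move=> -> [] E; apply: (eq_of_mulf_subr (natr_neq0 char0 (ltn0Sn n))); rewrite subr0 -?E //.
  by rewrite -[LHS]opprK -mulNr -E oppr0.
have b7 : b 7%N = 0.
  move: E7; rewrite T //; case: a0 => -[-> -> -> -> ->] /esym E.
    by apply: (scaled 9239 _ _ E); left; ring.
  by apply: (scaled 7279 _ _ E); left; ring.
have b6 : b 6%N = 0.
  move: (E6 b7); rewrite T //; case: a0 => -[-> -> _ -> _] /esym E.
    by apply: (scaled 9239 _ _ E); right; ring.
  by apply: (scaled 7864 _ _ E); right; ring.
have b5 : b 5%N = 0.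
  move: (E5 b7 b6); rewrite T //; case: a0 => -[-> -> -> _ _] /esym E.
    by apply: (scaled 9239 _ _ E); left; ring.
  by apply: (scaled 8711 _ _ E); left; ring.
have b4 : b 4%N = 0.
  move: (E4 b7 b6 b5); rewrite T //; case: a0 => -[-> -> _ _ _] /esym E.
    by apply: (scaled 9239 _ _ E); right; ring.
  by apply: (scaled 9701 _ _ E); right; ring.
by [].
Qed.

(** * Normalization of cocycles and their radical *)

Section Cocycles.
Variables (K : fieldType) (g : lieAlgType K) (e : 14.-tuple g) (alpha : nat -> nat -> K).
Hypotheses (law : A14 e alpha) (alpha714 : alpha 7 14 = 0).
Implicit Types (x y z : g) (w : bform g).
Local Notation v i := (bvec e i).
Local Notation xi i := (bdual e i).

Let e_basis : basis_of {:g} e. Proof. by case: law. Qed.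

Lemma lie_bvec_eq0 i j : (1 < i < 15)%N -> (1 < j < 15)%N -> (14 < i + j)%N ->
  lie (v i) (v j) = 0.
Proof.
have main p q : (1 < p)%N -> (p <= q < 15)%N -> (14 < p + q)%N -> lie (v p) (v q) = 0.
  move=> hp hq pq; rewrite (bvec_expand e_basis (lie _ _)) big_nat big1 // => r hr.
  by rewrite -(subnKC (_ : p <= q)%N) ?(bdual_lie law) ?strc_small ?scale0r //; lia.
move=> hi hj ij; have [le_ij|lt_ji] := leqP i j; first by rewrite main //; lia.
by rewrite lieC main ?oppr0 //; lia.
Qed.

(** The triple (e_1, e_{i-1}, e_j), where [e_{i-1}, e_j] = 0, moves the pair (i, j) to (i - 1, j +
    1) until the second index passes 14. For index sum 16 the shift would stop at (2, 14), so that
    case needs [form_eq0_16]. *)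
Lemma form_eq0_17 w i j : Z2 w -> (1 < i < 15)%N -> (1 < j < 15)%N -> (16 < i + j)%N ->
  w (v i) (v j) = 0 :> K.
Proof.
move=> Zw; have [n] := ubnP (15 - j); elim: n i j => // n IH [|i] j // hn hi hj ij.
have := Z2_dform Zw (v 1) (v i) (v j).
rewrite /dform !(lie1_bvec law) ?lie_bvec_eq0 ?bform0l ?addr0; [|lia..].
have -> : w (v j.+1) (v i) = 0 :> K; last by rewrite subr0.
have [j14|j14] := ltnP j 14; last by rewrite bvec_out // bform0l.
by rewrite (Z2_alt Zw (v i)) IH ?oppr0 //; lia.
Qed.

(** The index 14 is left out: [e_1, e_14] = 0, so no coboundary changes w(e_1, e_14). *)
Definition normalized w := forall i, (1 < i < 14)%N -> w (v 1) (v i) = 0 :> K.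

Lemma normalized1 w x : (forall x, w x x = 0) -> normalized w ->
  w (v 1) x = (w (v 1) (v 14) : K) * xi 14 x :> K.
Proof.
move=> w0 nw; rewrite {1}(bvec_expand e_basis x) linear_sum big_nat_recr //= big_nat.
rewrite big1 ?add0r => [|r hr]; first by rewrite linearZ /= mulrC.
have [->|r1] := eqVneq r 1%N; first by rewrite linearZ /= w0 scaler0.
by rewrite linearZ /= nw ?scaler0 //; lia.
Qed.

Lemma normalizeP w : Z2 w ->
  exists w', [/\ Z2 w', normalized w', w - w' \in B2 g & w' (v 1) (v 14) = w (v 1) (v 14)].
Proof.
move=> Zw.
(* Chosen so that f([e_1, e_j]) = f(e_{j+1}) = w(e_1, e_j). *)
pose f : 'Hom(g, K^o) := \sum_(2 <= j < 14) (w (v 1) (v j) : K) *: xi j.+1.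
have fE i : (1 < i < 14)%N -> f (v i.+1) = w (v 1) (v i).
  move=> hi; rewrite sum_lfunE (bigD1_seq i) ?iota_uniq ?mem_index_iota //=.
  rewrite scale_lfunE (bdual_bvec e_basis) ?eqxx; [|lia..].
  rewrite big_nat_cond big1 => [|j /andP[hj ji]].
    by rewrite addr0 /GRing.scale /= mulr1.
  by rewrite scale_lfunE (bdual_bvec e_basis) ?eqSS ?(negbTE ji) ?scaler0 //; lia.
have cE i : (1 < i < 15)%N -> (w - coboundary f) (v 1) (v i) = (w (v 1) (v i) : K) - f (v i.+1) :> K.
  by move=> hi; rewrite !(add_lfunE, opp_lfunE) coboundaryE (lie1_bvec law).
exists (w - coboundary f); split.
- by rewrite addrC -scaleN1r; apply: Z2_linear Zw; exact: Z2_coboundary.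
- by move=> i hi; rewrite cE ?fE ?subrr //; lia.
- by rewrite opprB addrC subrK; apply/memB2; exists f => x y; rewrite coboundaryE.
- by rewrite cE // (bvec_out _ (isT : (14 < 15)%N)) linear0 subr0.
Qed.

Lemma normalized_ccoef w : Z2 w -> normalized w ->
  forall d i, (1 < i)%N -> (i + d < 15)%N ->
  w (v i) (v (i + d)) = ccoef alpha (w (v 1) (v 14)) (fun k => w (v k) (v k.+1)) d i :> K.
Proof.
move=> Zw nw; apply: (spread_form law Zw) => [d i hi hd|i hi]; last first.
  by rewrite /cut; case: ifP => // i8; rewrite form_eq0_17 //; lia.
by rewrite normalized1 ?(bdual_lie law) //; exact: Zw.1.
Qed.

Lemma normalized_dcoef w : Z2 w -> normalized w ->
  forall i j k, (1 < i)%N -> (i < j)%N -> (j < k < 15)%N ->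
  dcoef alpha (ccoef alpha (w (v 1) (v 14)) (fun k => w (v k) (v k.+1))) i j k = 0.
Proof.
move=> Zw nw i j k hi ij jk.
by rewrite -(dform_dcoef law alpha714 Zw.1 (normalized_ccoef Zw nw)) ?Z2_dform.
Qed.

Lemma form_B2 w w' i j : w - w' \in B2 g -> (1 < i < 15)%N -> (1 < j < 15)%N -> (14 < i + j)%N ->
  w (v i) (v j) = w' (v i) (v j) :> K.
Proof.
move=> /memB2[f wE] hi hj ij; apply/eqP; rewrite -subr_eq0; apply/eqP.
have := wE (v i) (v j); rewrite lie_bvec_eq0 // linear0 => <-.
by rewrite !(add_lfunE, opp_lfunE).
Qed.

(** Coboundaries vanish on these pairs, so [w] may be normalized. For index sum 16 the recursion
    then starts from w(e_8, e_8) = 0. *)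
Lemma form_eq0_16 w i j : Z2 w -> (1 < i < 15)%N -> (1 < j < 15)%N -> (15 < i + j)%N ->
  w (v i) (v j) = 0 :> K.
Proof.
move=> Zw hi hj ij; have [w' [Zw' nw' ww' _]] := normalizeP Zw.
rewrite (form_B2 ww') //; last by lia.
rewrite (skew_form law Zw'.1 (normalized_ccoef Zw' nw')) //.
by rewrite /skew; case: ifP => lt_ij; rewrite ccoef_small ?oppr0 //; lia.
Qed.

Lemma bvec14_radical w : Z2 w -> w (v 1) (v 14) = 0 -> ~ Defs.nondegenerate w.
Proof.
move=> Zw c0 /(_ (v 14)) nd.
suff : v 14 = 0.
  move/(congr1 (fun x => xi 14 x : K)); rewrite linear0 (bdual_bvec e_basis) //= => /eqP.
  by rewrite oner_eq0.
apply: nd; apply: (linear_zero e_basis (f := fun y => w (v 14) y)) => [a y y'|j hj].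
  exact: bformDr.
have [->|j1] := eqVneq j 1%N; first by rewrite (Z2_alt Zw (v 1)) c0 oppr0.
by rewrite form_eq0_16 //; lia.
Qed.

(* [e_12, e_13, e_14] pair only with [e_1, e_2], so a combination is in the radical. *)
Lemma form_12_3_radical w : Z2 w -> w (v 12) (v 3) = 0 -> ~ Defs.nondegenerate w.
Proof.
move=> Zw w123; have [c0|c0] := eqVneq (w (v 1) (v 14) : K) 0; first exact: bvec14_radical.
move=> nd.
(* [y1] and [y2] cancel the pairing with e_2, which e_14 does not affect; [z] then cancels the
   pairing with e_1. *)
have [y1 [y2 [yE y0]]] : exists y1 y2 : K,
    y1 * w (v 12) (v 2) + y2 * w (v 13) (v 2) = 0 /\ (y1 != 0) || (y2 != 0).
  have [q0|q0] := eqVneq (w (v 13) (v 2) : K) 0.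
    by exists 0, 1; rewrite q0 mul0r mulr0 addr0 oner_eq0 orbT.
  exists (w (v 13) (v 2)), (- w (v 12) (v 2)); rewrite q0; split=> //.
  by rewrite mulNr mulrC subrr.
pose z : K := (y1 * w (v 12) (v 1) + y2 * w (v 13) (v 1)) / w (v 1) (v 14).
have wE y : w (y1 *: v 12 + (y2 *: v 13 + z *: v 14)) y
    = y1 * w (v 12) y + (y2 * w (v 13) y + z * w (v 14) y) :> K.
  by rewrite !bformDl -[z *: _]addr0 bformDl bform0l addr0.
have x0 : y1 *: v 12 + (y2 *: v 13 + z *: v 14) = 0.
  apply: nd; apply: (linear_zero e_basis) => [a y y'|j hj]; first exact: bformDr.
  rewrite wE; have [->|j1] := eqVneq j 1%N.
    by rewrite (Z2_alt Zw (v 1) (v 14)) mulrN /z divfK // addrA subrr.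
  have [->|j2] := eqVneq j 2%N; first by rewrite (form_eq0_16 (i := 14) Zw) // mulr0 addr0.
  rewrite (form_eq0_16 (i := 13) Zw) ?(form_eq0_16 (i := 14) Zw); [|lia..].
  have [->|j3] := eqVneq j 3; first by rewrite w123 !mulr0 !addr0.
  by rewrite (form_eq0_16 Zw) ?mulr0 ?addr0 //; lia.
have y1E : y1 = 0.
  have := congr1 (fun x => xi 12 x : K) x0.
  by rewrite !dual_linear linear0 -[z *: _]addr0 dual_linear linear0 !(bdual_bvec e_basis) //= !mulr0 !addr0 mulr1.
have y2E : y2 = 0.
  have := congr1 (fun x => xi 13 x : K) x0.
  by rewrite !dual_linear linear0 -[z *: _]addr0 dual_linear linear0 !(bdual_bvec e_basis) //= !mulr0 !addr0 add0r mulr1.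
by rewrite y1E y2E eqxx in y0.
Qed.
End Cocycles.

(** * The classes of [omega1] and [omega2], and cocycles with c = 0 *)

Section Omegas.
Variables (K : fieldType) (g : lieAlgType K) (e : 14.-tuple g) (alpha : nat -> nat -> K).
Hypotheses (law : A14 e alpha) (alpha714 : alpha 7 14 = 0).
Implicit Types (x y z : g) (w : bform g).
Local Notation v i := (bvec e i).
Local Notation xi i := (bdual e i).

Let e_basis : basis_of {:g} e. Proof. by case: law. Qed.

(** Yields closed formulas for the coordinates 2 to 5 of a bracket, all that the closedness of the
    two omegas requires. *)
Lemma coboundary_wedge r (w : bform g) : (0 < r < 15)%N -> (forall x, w x x = 0) ->
  (forall j, (1 < j < 15)%N -> w (v 1) (v j) = (r == j.+1)%:R :> K) ->
  (forall d i, (1 < i)%N -> (i + d.+1 < 15)%N ->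
     w (v i) (v (i + d.+1)) = strc alpha r d.+1 i :> K) ->
  coboundary (xi r) = w.
Proof.
move=> hr w0 w1 wv; apply/eqP; rewrite -subr_eq0; apply/eqP/(bform_zero e_basis) => [x|i j hi hj].
  by rewrite !(add_lfunE, opp_lfunE) coboundaryE liexx linear0 w0 subr0.
rewrite !(add_lfunE, opp_lfunE) coboundaryE; have [i1|i1] := eqVneq i 1%N.
  rewrite i1 (lie1_bvec law) ?w1; [|lia..]; have [j14|j14] := ltnP j 14.
    by rewrite (bdual_bvec e_basis) ?subrr //; lia.
  by rewrite bvec_out // linear0 (_ : r == j.+1 = false) ?subr0 //; lia.
have -> : j = (i + (j - i).-1.+1)%N by lia.
by rewrite (bdual_lie law) ?wv ?subrr //; lia.
Qed.

Lemma lie_coord2 x y : xi 2 (lie x y) = 0 :> K.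
Proof.
rewrite -coboundaryE (@coboundary_wedge 2 0) ?zero_lfunE //.
- by move=> z; rewrite !zero_lfunE.
- by move=> j hj; rewrite !zero_lfunE (_ : 2 == j.+1 = false)%N //; lia.
- by move=> d i hi hd; rewrite !zero_lfunE strc_small //; lia.
Qed.

Ltac wedge_bvec := rewrite ?wedgeE !(bdual_bvec e_basis); [|lia..].

Lemma lie_coord3 x y : xi 3 (lie x y) = xi 1 x * xi 2 y - xi 2 x * xi 1 y :> K.
Proof.
rewrite -coboundaryE (@coboundary_wedge 3 (wedge (xi 1) (xi 2))) ?wedgeE //.
- exact: wedge_alt.
- by move=> j hj; wedge_bvec; rewrite mul1r mul0r subr0 eqSS.
- move=> d i hi hd; wedge_bvec; rewrite strc_small; [|lia..].
  have -> : (1 == i)%N = false by lia.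
  have -> : (1 == i + d.+1)%N = false by lia.
  by rewrite mul0r mulr0 subrr.
Qed.

Lemma lie_coord4 x y : xi 4 (lie x y) = xi 1 x * xi 3 y - xi 3 x * xi 1 y :> K.
Proof.
rewrite -coboundaryE (@coboundary_wedge 4 (wedge (xi 1) (xi 3))) ?wedgeE //.
- exact: wedge_alt.
- by move=> j hj; wedge_bvec; rewrite mul1r mul0r subr0 eqSS.
- move=> d i hi hd; wedge_bvec; rewrite strc_small; [|lia..].
  have -> : (1 == i)%N = false by lia.
  have -> : (1 == i + d.+1)%N = false by lia.
  by rewrite mul0r mulr0 subrr.
Qed.

Lemma lie_coord5 x y : xi 5 (lie x y) = xi 1 x * xi 4 y - xi 4 x * xi 1 y
  + alpha 2 5 * (xi 2 x * xi 3 y - xi 3 x * xi 2 y) :> K.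
Proof.
rewrite -coboundaryE
  (@coboundary_wedge 5 (alpha 2 5 *: wedge (xi 2) (xi 3) + wedge (xi 1) (xi 4))) //.
- by rewrite !(add_lfunE, scale_lfunE) !wedgeE addrC.
- by move=> z; rewrite !(add_lfunE, scale_lfunE) !wedge_alt scaler0 addr0.
- move=> j hj; rewrite !(add_lfunE, scale_lfunE); wedge_bvec.
  by rewrite !(mul1r, mul0r, mulr0) !subr0 scaler0 add0r eqSS.
- move=> d i hi hd; rewrite !(add_lfunE, scale_lfunE); wedge_bvec.
  have -> : (1 == i)%N = false by lia.
  have -> : (1 == i + d.+1)%N = false by lia.
  rewrite mul0r mulr0 subrr addr0 (_ : (2 == i + d.+1)%N = false); last by lia.
  rewrite mulr0 subr0 -natrM mulnb.
  have [[-> ->]|E] : (i = 2 /\ d = 0 \/ 5 < i.*2 + d.+1)%N by lia.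
    by rewrite /= (trunc_law law) // /GRing.scale /= mulr1.
  by rewrite strc_small // (_ : _ && _ = false) ?scaler0 //; lia.
Qed.

Lemma omega1E x y : omega1 e x y = xi 2 x * xi 3 y - xi 3 x * xi 2 y :> K.
Proof. exact: wedgeE. Qed.

Lemma omega2E x y : omega2 e x y = xi 2 x * xi 5 y - xi 5 x * xi 2 y
  - (xi 3 x * xi 4 y - xi 4 x * xi 3 y) :> K.
Proof. by rewrite !(add_lfunE, opp_lfunE) !wedgeE. Qed.

Lemma omega1_bvec i j : (0 < i < 15)%N -> (0 < j < 15)%N -> omega1 e (v i) (v j) =
  (2 == i)%N%:R * (3 == j)%N%:R - (3 == i)%N%:R * (2 == j)%N%:R :> K.
Proof. by move=> hi hj; rewrite omega1E !(bdual_bvec e_basis). Qed.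

Lemma omega2_bvec i j : (0 < i < 15)%N -> (0 < j < 15)%N -> omega2 e (v i) (v j) =
  (2 == i)%N%:R * (5 == j)%N%:R - (5 == i)%N%:R * (2 == j)%N%:R
  - ((3 == i)%N%:R * (4 == j)%N%:R - (4 == i)%N%:R * (3 == j)%N%:R) :> K.
Proof. by move=> hi hj; rewrite omega2E !(bdual_bvec e_basis). Qed.

Lemma Z2_omega1 : Z2 (omega1 e).
Proof.
split=> [x|x y z]; first exact: wedge_alt.
by rewrite !omega1E !lie_coord2 !lie_coord3; ring.
Qed.

Lemma Z2_omega2 : Z2 (omega2 e).
Proof.
split=> [x|x y z]; first by rewrite omega2E; ring.
by rewrite !omega2E !lie_coord2 !lie_coord3 !lie_coord4 !lie_coord5; ring.
Qed.

Hypotheses (char0 : [pchar K] =i pred0) (alpha25 : alpha 2 5 = 1).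

(** 4620 is the least common multiple of the denominators 10, 70, 420, 2310 of the Witt
    constants. *)
Definition scaled k s : K := 4620 * alpha k s.

Lemma jacobi_scaled : jacobi scaled.
Proof.
move=> i j k r hi ij jk hk hr; rewrite (dcoef_scale _ (W := strc alpha r)).
  by rewrite (jacobi_law law) ?mulr0.
exact: strc_scale.
Qed.

Lemma flat_or_witt : flat0 scaled \/ witt0 scaled.
Proof.
have s25 : scaled 2 5 = 4620 by rewrite /scaled alpha25 mulr1.
have [s37|/eqP s37] := eqVneq (scaled 3 7) 0; [left|right].
  exact: flat_weight0 char0 _ jacobi_scaled s25 s37.
exact: witt_weight0 char0 _ jacobi_scaled s25 s37.
Qed.

(** The parameter c stays unscaled, since it enters [ccoef] multiplied by structure constants. *)
Definition scaled_superdiag w k : K := 4620 * (w (v k) (v k.+1) : K).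

Lemma scaled_dcoef w : Z2 w -> normalized e w ->
  forall i j k, (1 < i)%N -> (i < j)%N -> (j < k < 15)%N ->
  dcoef scaled (ccoef scaled (w (v 1) (v 14)) (scaled_superdiag w)) i j k = 0.
Proof.
move=> Zw nw i j k hi ij jk; rewrite (@dcoef_scale _ 4620 alpha _ _ i j k (ccoef_scale 4620 alpha _ _)).
by rewrite (normalized_dcoef law) ?mulr0.
Qed.

Lemma cocycle_span w : Z2 w -> w (v 1) (v 14) = 0 ->
  exists2 u, u \in <<[:: omega1 e; omega2 e]>>%VS & w - u \in B2 g.
Proof.
move=> Zw c0; have [w' [Zw' nw' ww' cE]] := normalizeP law Zw.
have := scaled_dcoef Zw' nw'; rewrite cE c0 => T.
have {T} := cocycle_lead_eq0 char0 flat_or_witt T.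
have z4620 (y : K) : 4620 * y = 0 -> y = 0.
  by move=> E; apply: (eq_of_mulf_subr (natr_neq0 char0 (isT : (0 < 4620)%N))); rewrite subr0.
case=> /z4620 b7 /z4620 b6 /z4620 b5 /z4620 b4.
pose b2 : K := w' (v 2) (v 3); pose b3 : K := w' (v 3) (v 4).
(* The minus sign comes from omega_2(e_3, e_4) = -1. *)
pose u := b2 *: omega1 e - b3 *: omega2 e.
have us : u \in <<[:: omega1 e; omega2 e]>>%VS.
  by rewrite rpredB // rpredZ // memv_span ?inE ?eqxx ?orbT.
have Zu : Z2 u by apply: Z2_span us => ?; rewrite !inE => /orP[]/eqP->; [exact: Z2_omega1|exact: Z2_omega2].
exists u => //; suff <- : w' = u by [].
have Zd : Z2 (w' - u) by rewrite addrC -scaleN1r; apply: Z2_linear.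
have uE x y : u x y = b2 * omega1 e x y - b3 * omega2 e x y :> K.
  by rewrite !(add_lfunE, opp_lfunE, scale_lfunE).
have dE x y : (w' - u) x y = (w' x y : K) - u x y :> K.
  by rewrite !(add_lfunE, opp_lfunE).
have d1 j : (1 < j < 15)%N -> (w' - u) (v 1) (v j) = 0 :> K.
  move=> hj; have hj' : (0 < j < 15)%N by case/andP: hj => /ltnW -> ->.
  rewrite dE uE omega1_bvec // omega2_bvec //=.
  transitivity (w' (v 1) (v j) : K); first by ring.
  have [->|j14] := eqVneq j 14%N; first by rewrite cE c0.
  by rewrite nw' //; lia.
have nd : normalized e (w' - u) by move=> j hj; apply: d1; lia.
apply/eqP; rewrite -subr_eq0; apply/eqP/(bform_zero e_basis); first by case: Zd.
move=> i j hi hj; have [->|i1] := eqVneq i 1%N; first by apply: d1; lia.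
rewrite -(subnKC (_ : i <= j)%N); last by lia.
rewrite (normalized_ccoef law) //; [|lia..].
(* With [N := 0] the bounds on index sums are empty: the recursion with zero data gives zero. *)
apply: (spread_small (N := 0)); [| |lia|lia].
  by move=> d p _ _; rewrite d1 // mul0r.
move=> p hp _; rewrite /cut; case: ifP => // p8.
have {}p8 : (p < 8)%N by lia.
rewrite dE uE.
case: p hp p8 => [|[|[|[|[|[|[|[|p]]]]]]]] //= _ _;
  by rewrite omega1_bvec // omega2_bvec //= /b2 /b3 ?b4 ?b5 ?b6 ?b7; ring.
Qed.
End Omegas.

(** * The flat case and the obstructed Witt case *)

Section Main.
Variables (K : fieldType) (g : lieAlgType K) (e : 14.-tuple g) (alpha : nat -> nat -> K).
Hypotheses (law : A14 e alpha) (alpha714 : alpha 7 14 = 0).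
Hypotheses (char0 : [pchar K] =i pred0) (alpha25 : alpha 2 5 = 1).
Implicit Types (x y z : g) (w : bform g).
Local Notation v i := (bvec e i).
Local Notation xi i := (bdual e i).
Local Notation a := (scaled alpha).

Let e_basis : basis_of {:g} e. Proof. by case: law. Qed.

(** A multiple of [w0] is subtracted to reach c = 0. In the second alternative every cocycle has c =
    0, and the quotient [k] is 0 by convention. *)
Lemma cocycle_span3 w0 : Z2 w0 ->
  w0 (v 1) (v 14) <> 0 \/ (forall w, Z2 w -> w (v 1) (v 14) = 0) ->
  H2_span [:: omega1 e; omega2 e; w0].
Proof.
move=> Zw0 c0; apply: H2_spanP => [w|w Zw].
  rewrite !inE => /or3P[]/eqP-> //; [exact: Z2_omega1 law alpha714|exact: Z2_omega2 law alpha714].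
pose k : K := w (v 1) (v 14) / w0 (v 1) (v 14).
have Zwk : Z2 (- k *: w0 + w) by exact: Z2_linear.
have [|u us uB] := cocycle_span law alpha714 char0 alpha25 Zwk.
  case: c0 => [/eqP c0|c0]; last exact: c0.
  by rewrite !(add_lfunE, scale_lfunE) /GRing.scale /= mulNr /k divfK // addNr.
exists (k *: w0 + u); last by move: uB; rewrite scaleNr (addrC (- _)) opprD addrA.
have us3 : u \in <<[:: omega1 e; omega2 e; w0]>>%VS.
  move: u us {uB}; apply/subvP/sub_span => w'.
  by rewrite !inE => /orP[]/eqP->; rewrite eqxx ?orbT.
by rewrite rpredD // rpredZ // memv_span // !inE eqxx !orbT.
Qed.

Lemma flat_not_symplectic : alpha 3 7 = 0 -> ~ symplectic g.
Proof.
move=> a37 [w Zw]; apply: (form_12_3_radical law alpha714 Zw).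
have [w' [Zw' nw' ww' _]] := normalizeP law Zw.
rewrite (form_B2 law alpha714 ww') // (Z2_alt Zw').
have fl : flat0 a.
  case: (flat_or_witt law alpha714 char0 alpha25) => // -[_ + _ _ _].
  by rewrite /scaled a37 mulr0 => /esym/eqP; rewrite (negbTE (natr_neq0 char0 (isT : (0 < 462)%N))).
have [E1 E2] := flat_cocycle_w0 (scaled_superdiag e w') (w' (v 1) (v 14)) fl.
have b7 : scaled_superdiag e w' 7 = 0.
  apply: (eq_of_mulf_subr (natr_neq0 char0 (isT : (0 < 9240)%N))); rewrite subr0 -E1.
  exact: (scaled_dcoef law alpha714 Zw' nw' (i := 2) (j := 3) (k := 10)).
have E3 := normalized_ccoef law alpha714 Zw' nw' (isT : (1 < 3)%N) (isT : (3 + 9 < 15)%N).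
rewrite -[12%N]/(3 + 9)%N E3; apply/eqP; rewrite oppr_eq0; apply/eqP.
apply: (eq_of_mulf_subr (natr_neq0 char0 (isT : (0 < 4620)%N))); rewrite subr0.
by rewrite -ccoef_scale [LHS]E2.
Qed.

Lemma cocycle_e1_e14_eq0 : alpha 3 7 <> 0 -> alpha 3 10 <> P14 alpha ->
  forall w, Z2 w -> w (v 1) (v 14) = 0.
Proof.
move=> a37 nP w Zw; have [w' [Zw' nw' _ <-]] := normalizeP law Zw.
have W : witt0 a.
  case: (flat_or_witt law alpha714 char0 alpha25) => // -[_ + _ _ _].
  move/eqP; rewrite /scaled mulf_eq0 (negbTE (natr_neq0 char0 (isT : (0 < 4620)%N))) /=.
  by move/eqP.
have J := jacobi_scaled law alpha714.
have [m [n [a26 a38 a410 a512 a614]]] := witt_weight1 char0 J W.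
set c : K := w' (v 1) (v 14); have [h cE] : exists h, c = 13 * h.
  by exists (c / 13); rewrite mulrC divfK ?natr_neq0.
pose b := scaled_superdiag e w'.
have T i j k : (1 < i)%N -> (i < j)%N -> (j < k < 15)%N -> dcoef a (ccoef a (13 * h) b) i j k = 0.
  by rewrite -cE; exact: (scaled_dcoef law alpha714 Zw' nw').
have b7 : b 7%N = 5 * h.
  (* 7280 = 560 * 13, from the condition on (2,3,10) with c = 13 h. *)
  apply: (eq_of_mulf_subr (natr_neq0 char0 (isT : (0 < 7280)%N))).
  transitivity (dcoef a (ccoef a (13 * h) b) 2 3 10); last exact: T.
  by rewrite (witt_cocycle_w0 _ _ W).1; ring.
have P0 : P14_scaled a m n != 0.
  by apply/eqP => /(P14_scaled_eq0 char0 (fun _ _ => erefl) a26 a38).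
have := cocycle_obstruction char0 W b7 a26 a38 a410 a512 a614 J (T 2 3 8 isT isT isT)%N.
rewrite T // mulr0 => /esym/eqP; rewrite !mulf_eq0 oppr_eq0 (negbTE P0) orbF.
rewrite (negbTE (natr_neq0 char0 (isT : (0 < 5)%N))) /= => /eqP h0.
by rewrite -/c cE h0 mulr0.
Qed.

(** Brackets do not lower index sums, so each term evaluates [W] on a pair of index sum above 15. *)
Lemma dcoef_small W i j k : (1 < i)%N -> (i < j)%N -> (j < k < 15)%N -> (15 < i + j + k)%N ->
  (forall d p, (1 < p)%N -> (15 < p.*2 + d)%N -> W d p = 0) -> dcoef alpha W i j k = 0.
Proof.
move=> hi ij jk s16 W0.
have term p q t r : (1 < p)%N -> (p < q)%N -> (1 < t)%N -> (15 < p + q + t)%N -> (4 < r < 15)%N ->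
    strc alpha r (Nat.sub q p) p * skew W r t = 0.
  move=> hp pq ht pqt hr; have [rs|rs] := ltnP r (p + q).
    by rewrite strc_small ?mul0r //; lia.
  by rewrite /skew; case: ifP => rt; rewrite W0 ?oppr0 ?mulr0 //; lia.
have fold0 F (s : seq nat) : (forall r, r \in s -> F r = 0 :> K) ->
    foldr (fun r t => F r + t) 0 s = 0.
  elim: s => //= r s IH F0; rewrite F0 ?mem_head ?IH ?addr0 // => q qs.
  by apply: F0; rewrite inE qs orbT.
apply: fold0 => r; rewrite mem_iota => hr.
by rewrite !term ?subrr ?addr0 //; lia.
Qed.

Lemma exists_extension (W : nat -> nat -> K) : (forall i, W 0%N i = 0) ->
  exists w : bform g, [/\ forall x, w x x = 0,
    forall j, (1 < j < 14)%N -> w (v 1) (v j) = 0 :> K, w (v 1) (v 14) = 13 :> K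
    & forall d i, (1 < i)%N -> (i + d < 15)%N -> w (v i) (v (i + d)) = W d i :> K].
Proof.
move=> W0; exists (form_of e (fun i j =>
  if i == 1%N then (if j == 14%N then 13 else 0) else W (j - i)%N i)).
split=> [x|j hj||d i hi hd]; first exact: form_of_alt.
- rewrite (form_of_bvec e_basis) //=; last by lia.
  by rewrite (_ : j == 14 = false)%N //; lia.
- by rewrite (form_of_bvec e_basis).
have [->|d0] := eqVneq d 0%N; first by rewrite addn0 form_of_alt W0.
rewrite (form_of_bvec e_basis) ?addKn; [|lia..].
by rewrite (_ : i == 1 = false)%N //; lia.
Qed.

(** * Construction of the symplectic cocycle *)

Section Extension.
Variables (W : nat -> nat -> K) (w : bform g).
Hypotheses (WS : forall d i, W d.+2 i = 13 * strc alpha 14 d.+1 i - W d i.+1)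
  (W_small : forall d i, (1 < i)%N -> (15 < i.*2 + d)%N -> W d i = 0).
Hypotheses (w_alt : forall x, w x x = 0)
  (w1 : forall j, (1 < j < 14)%N -> w (v 1) (v j) = 0 :> K)
  (w114 : w (v 1) (v 14) = 13 :> K)
  (wW : forall d i, (1 < i)%N -> (i + d < 15)%N -> w (v i) (v (i + d)) = W d i :> K).
Let T i j k := dform w (v i) (v j) (v k).

Lemma extension_dform1 x y : dform w (v 1) x y = 0.
Proof.
apply: (linear_zero e_basis (f := fun x => dform w (v 1) x y)) x => [b x x'|i hi].
  exact: dformP2.
apply: (linear_zero e_basis (f := fun y => dform w (v 1) (v i) y)) y => [b y y'|j hj].
  exact: dformP3.
wlog ij : i j hi hj / (i <= j)%N.
  move=> H; have [|ji] := leqP i j; first exact: H.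
  by rewrite dform_swap23 // H ?oppr0 //; lia.
have [->|i1] := eqVneq i 1%N; first exact: dform_xx.
have [<-|nij] := eqVneq i j; first by rewrite dform_swap23 // dform_swap12 // dform_swap23 // dform_xx ?oppr0.
have -> : j = (i + (j - i).-1.+1)%N by lia.
have : (i + (j - i).-1.+1 < 15)%N by lia.
move: (j - i).-1 => d hd.
rewrite /dform !(lie1_bvec law); [|lia..].
have -> : w (lie (v i) (v (i + d.+1))) (v 1) = - (13 * strc alpha 14 d.+1 i) :> K.
  by rewrite (alt_skew w_alt (v 1)) (normalized1 law _ w_alt w1) w114 (bdual_lie law) //; lia.
have -> : w (v (i + d.+1).+1) (v i) = - W d.+2 i :> K.
  (* Past the end of the basis the vector is 0, and [W] agrees because the index sum exceeds 15. *)
  rewrite -addnS (alt_skew w_alt (v i)). have [d14|d14] := ltnP (i + d.+2) 15.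
    by rewrite wW //; lia.
  by rewrite (bvec_out e d14) linear0 W_small ?oppr0 //; lia.
by rewrite -addSnnS wW ?WS; [ring | lia..].
Qed.

Lemma extension_dform_derive i j k : (1 < i < 15)%N -> (1 < j < 15)%N -> (1 < k < 15)%N ->
  T i.+1 j k + T i j.+1 k + T i j k.+1 = 0.
Proof.
move=> hi hj hk; have := dform_derive (v i) (v j) (v k) w_alt extension_dform1.
by rewrite !(lie1_bvec law).
Qed.

Hypothesis W_dcoef : [/\ dcoef alpha W 2 3 10 = 0, dcoef alpha W 2 5 8 = 0 & dcoef alpha W 2 3 9 = 0]
  /\ [/\ dcoef alpha W 2 3 8 = 0, dcoef alpha W 2 3 7 = 0, dcoef alpha W 2 3 6 = 0 & dcoef alpha W 2 3 4 = 0].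

(* [extension_dform_derive] relates the values on the triples of index sum [s + 1]
   for each triple of sum [s]; the seven values in [W_dcoef] determine them all. *)
Lemma extension_dform_eq0 i j k : (1 < i)%N -> (i < j)%N -> (j < k < 15)%N -> T i j k = 0.
Proof.
have TE i' j' k' : (1 < i')%N -> (i' < j')%N -> (j' < k' < 15)%N -> T i' j' k' = dcoef alpha W i' j' k'.
  by move=> *; rewrite /T (dform_dcoef law alpha714 w_alt wW).
have xxy i' j' : T i' i' j' = 0 by exact: dform_xx.
have xyy i' j' : T i' j' j' = 0.
  by rewrite /T dform_swap12 // dform_swap23 // dform_xx ?oppr0.
have D := extension_dform_derive.
case: W_dcoef => [[]]; rewrite -!TE // => t2310 t258 t239 [t238 t237 t236 t234].
have t249 : T 2 4 9 = 0 by have := D 2 3 9 isT isT isT; rewrite xxy t2310 add0r addr0.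
have t348 : T 3 4 8 = 0 by have := D 2 4 8 isT isT isT; rewrite t258 t249 !addr0.
have t357 : T 3 5 7 = 0 by have := D 3 4 7 isT isT isT; rewrite xxy t348 add0r addr0.
have t267 : T 2 6 7 = 0 by have := D 2 5 7 isT isT isT; rewrite t357 t258 add0r addr0.
have t456 : T 4 5 6 = 0 by have := D 3 5 6 isT isT isT; rewrite xyy t357 !addr0.
(* Index sum 14 is the one place where the relations do not simply chain: they leave 2 T(3,4,7) =
   0. *)
have t248 : T 2 4 8 = 0 by have := D 2 3 8 isT isT isT; rewrite xxy t239 add0r addr0.
have t257 : T 2 5 7 = - T 3 4 7.
  by have := D 2 4 7 isT isT isT; rewrite t248 addr0 addrC => /eqP; rewrite addr_eq0 => /eqP.
have t356 : T 3 5 6 = T 3 4 7.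
  have := D 2 5 6 isT isT isT; rewrite xyy t257 addr0 => /eqP.
  by rewrite subr_eq0 => /eqP.
have t347 : T 3 4 7 = 0.
  apply: (eq_of_mulf_subr (natr_neq0 char0 (isT : (0 < 2)%N))).
  by have := D 3 4 6 isT isT isT; rewrite xxy t356 add0r subr0 mulr_natl mulr2n.
rewrite t347 ?oppr0 in t257 t356.
have t247 : T 2 4 7 = 0 by have := D 2 3 7 isT isT isT; rewrite xxy t238 add0r addr0.
have t346 : T 3 4 6 = 0 by have := D 3 4 5 isT isT isT; rewrite xxy xyy !add0r.
have t256 : T 2 5 6 = 0 by have := D 2 4 6 isT isT isT; rewrite t346 t247 add0r addr0.
have t246 : T 2 4 6 = 0 by have := D 2 3 6 isT isT isT; rewrite xxy t237 add0r addr0.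
have t345 : T 3 4 5 = 0 by have := D 2 4 5 isT isT isT; rewrite xyy t246 !addr0.
have t245 : T 2 4 5 = 0 by have := D 2 3 5 isT isT isT; rewrite xxy t236 add0r addr0.
have t235 : T 2 3 5 = 0 by have := D 2 3 4 isT isT isT; rewrite xxy xyy !add0r.
move=> hi ij jk; have [s16|s15] := ltnP 15 (i + j + k).
  by rewrite TE //; exact: dcoef_small.
have /or3P[/eqP i2|/eqP i3|/eqP i4] : [|| i == 2, i == 3 | i == 4]%N by lia.
- rewrite i2 in ij s15 *; have : (j < 7)%N by lia.
  case: j ij jk s15 => [|[|[|[|[|[|[|j]]]]]]] // _ jk s15 _; move: jk s15;
  by case: k => [|[|[|[|[|[|[|[|[|[|[|k]]]]]]]]]]] //; lia.
- rewrite i3 in ij s15 *; have : (j < 6)%N by lia.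
  case: j ij jk s15 => [|[|[|[|[|[|j]]]]]] // _ jk s15 _; move: jk s15;
  by case: k => [|[|[|[|[|[|[|[|[|k]]]]]]]]] //; lia.
rewrite i4 in ij s15 *; have jE : j = 5%N by lia.
by rewrite jE in jk s15 *; have -> : k = 6%N by lia.
Qed.

Lemma Z2_extension : Z2 w.
Proof.
split=> // x y z; apply: (dform_zero e_basis w_alt) => i j k hi ij jk.
have [->|i1] := eqVneq i 1%N; first exact: extension_dform1.
by apply: extension_dform_eq0 => //; lia.
Qed.

Lemma det_extension : (forall i, (1 < i < 8)%N -> W (15 - i.*2) i != 0) -> det_form e w <> 0.
Proof.
move=> Wd.
have lt_i i j : (i < j < 15)%N -> (1 < i)%N -> w (v i) (v j) = W (j - i) i :> K.
  by move=> ij hi; rewrite -{1}(subnKC (_ : i <= j)%N) ?wW //; lia.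
have sk := alt_skew w_alt.
apply: (det_form_neq0 e_basis) => [i j hi hj ij|i hi].
  have [lt_ij|lt_ji|->] := ltngtP i j; last exact: w_alt.
    by rewrite lt_i ?W_small //; lia.
  by rewrite sk lt_i ?W_small ?oppr0 //; lia.
have c13 : 13 <> 0 :> K by apply/eqP; exact: natr_neq0.
have [->|i1] := eqVneq i 1%N; first by rewrite w114.
have [->|i14] := eqVneq i 14%N.
  by rewrite sk w114; apply/eqP; rewrite oppr_eq0; apply/eqP.
have [i8|i8] := ltnP i 8.
  rewrite lt_i; [|lia..]; rewrite (_ : 15 - i - i = 15 - i.*2)%N; last by lia.
  by apply/eqP/Wd; lia.
rewrite sk lt_i; [|lia..]; apply/eqP; rewrite oppr_eq0.
by rewrite (_ : i - (15 - i) = 15 - (15 - i).*2)%N ?Wd //; lia.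
Qed.
End Extension.

(** Take c = 13 and scaled b_7 = 5, that is g = 1. Then (2,3,10) and (2,5,8) hold because 13 b_7 = 5
    c, (2,3,9) by weight 1, (2,3,8), (2,3,6), (2,3,4) by the choice of b_6, b_5, b_4, and (2,3,7)
    because the obstruction is zero. *)
Lemma symplectic_cocycle : alpha 3 7 <> 0 -> alpha 3 10 = P14 alpha ->
  exists w, [/\ Z2 w, det_form e w <> 0 & w (v 1) (v 14) <> 0].
Proof.
move=> a37 P.
have z4620 := natr_neq0 char0 (isT : (0 < 4620)%N).
have Wt : witt0 a.
  case: (flat_or_witt law alpha714 char0 alpha25) => // -[_ + _ _ _].
  by move/eqP; rewrite /scaled mulf_eq0 (negbTE z4620) /= => /eqP.
have J := jacobi_scaled law alpha714.
have [m [n [a26 a38 a410 a512 a614]]] := witt_weight1 char0 J Wt.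
have [b [b7 T238 T236 T234]] := witt_cocycle_exists char0 J Wt.
pose W := ccoef alpha 13 (fun k => b k / 4620).
have WE d i : ccoef a 13 b d i = 4620 * W d i.
  apply: spread_scale => [d' i'|k]; first by rewrite (strc_scale 4620 alpha) mulrCA.
  by rewrite /cut; case: ifP => _; rewrite ?mulr0 // mulrC divfK.
have WT i j k : dcoef a (ccoef a 13 b) i j k = 0 -> dcoef alpha W i j k = 0.
  rewrite (@dcoef_scale _ 4620 alpha W _ i j k WE) => /eqP; rewrite mulf_eq0 expf_eq0 (negbTE z4620) /=.
  by move/eqP.
have b75 : b 7%N = 5 * 1 by rewrite mulr1.
have T237 : dcoef a (ccoef a (13 * 1) b) 2 3 7 = 0.
  have z := natr_neq0 char0; apply: (eq_of_mulf_subr (c := 49 * 1331)).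
    by rewrite mulf_neq0 ?z.
  rewrite subr0; have := cocycle_obstruction char0 Wt b75 a26 a38 a410 a512 a614 J.
  rewrite mulr1 => /(_ T238); rewrite mulr1.
  rewrite ((P14_scaled_eq0 char0 (fun _ _ => erefl) a26 a38).2 P) mulr0 => <-; ring.
have T239 := witt_cocycle_w1 Wt b75 a26 a38 a410 a512 a614.
have [T2310 T258] := witt_cocycle_w0 b 13 Wt.
rewrite b7 in T2310 T258; rewrite mulr1 in T237 T239.
have Z35 : 13 * 5 - 5 * 13 = 0 :> K by ring.
rewrite Z35 !mulr0 in T2310 T258.
have [w [w_alt w1 w114 wW]] := exists_extension (W := W) (fun=> erefl).
have W_small d i := @ccoef_small K alpha 13 (fun k => b k / 4620) d i.
exists w; split.
- apply: (Z2_extension (W := W)) => //.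
  by split; split; exact: WT.
- apply: (det_extension (W := W)) => // i hi.
  have [A1 A2 A3 A4 A5] := witt_antidiagonal Wt b75.
  have nz (c : K) : c != 0 -> ccoef a (13 * 1) b (15 - i.*2)%N i = c -> W (15 - i.*2)%N i != 0.
    rewrite mulr1 => c0; rewrite WE => E; apply: contra c0 => /eqP W0.
    by rewrite -E W0 mulr0.
  have z := natr_neq0 char0.
  case: i hi nz => [|[|[|[|[|[|[|[|i]]]]]]]] // _ nz.
  + by apply: nz A1; rewrite mulr1 z.
  + by apply: nz A2; rewrite mulr1 z.
  + by apply: nz A3; rewrite mulr1 z.
  + by apply: nz A4; rewrite mulr1 z.
  + by apply: nz A5; rewrite mulr1 z.
  + by apply: (nz (b 7%N)) => //; rewrite b7 z.
- by rewrite w114; apply/eqP; exact: natr_neq0.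
Qed.
End Main.

(** * The lower central series and properties (b), (c) *)

Section CentralSeries.
Variables (K : fieldType) (g : lieAlgType K) (e : 14.-tuple g) (alpha : nat -> nat -> K).
Hypotheses (law : A14 e alpha).
Implicit Types (x y z u : g).
Local Notation v i := (bvec e i).
Local Notation xi i := (bdual e i).

Let e_basis : basis_of {:g} e. Proof. by case: law. Qed.

Lemma bvec_lcs j m : (1 < m)%N -> (j + 2 <= m)%N -> v m \in lcs g j.
Proof.
elim: j m => [|j IH] m hm jm; first exact: memvf.
have [m14|m14] := ltnP 14 m; first by rewrite bvec_out ?mem0v.
have -> : v m = - lie (v m.-1) (v 1).
  by rewrite -lieC (lie1_bvec law) ?prednK //; lia.
by rewrite rpredN /= memv_lie ?memvf // IH //; lia.
Qed.

Lemma propB_alpha714 : propB g -> alpha 7 14 = 0.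
Proof.
rewrite /propB => lcs5; have : lie (v 7) (v 8) \in liev (lcs g 5) (lcs g 5).
  by apply: memv_lie; apply: bvec_lcs.
rewrite lcs5 memv0 => /eqP lie78.
have /esym := bdual_lie_succ law (i := 7) (r := 14) isT isT.
by rewrite lie78 linear0.
Qed.

Hypothesis alpha714 : alpha 7 14 = 0.

(** Bracketing raises the lowest index by at least one. The alternative [r <= 2] covers the first
    step, which gains two: e_1 and e_2 both drop out of g^1. *)
Lemma bdual_lie_lt r u y m : (0 < r < 15)%N -> (forall i, (0 < i < m)%N -> (i < 15)%N -> xi i u = 0 :> K) ->
  (r <= m)%N || (r <= 2)%N -> xi r (lie u y) = 0 :> K.
Proof.
move=> hr u0 rm; rewrite (bvec_expand e_basis u) lieEl linear_sum /= linear_sum big_nat.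
apply: big1 => p hp; rewrite linearZ linearZ /= -lieEl.
have [pm|mp] := ltnP p m; first by rewrite u0 ?scale0r //; lia.
suff -> : xi r (lie (v p) y) = 0 :> K by rewrite scaler0.
apply: (linear_zero e_basis (f := fun y => xi r (lie (v p) y) : K)) y => [a y y'|q hq].
  by rewrite lieDr dual_linear.
have [pE|p1] := eqVneq p 1%N.
  rewrite pE.
  have [->|q1] := eqVneq q 1%N; first by rewrite liexx linear0.
  rewrite (lie1_bvec law); last by lia.
  have [q14|q14] := ltnP 14 q.+1; first by rewrite bvec_out // linear0.
  have rq : (r == q.+1) = false by lia.
  have hq' : (0 < q.+1 < 15)%N by lia.
  by rewrite (bdual_bvec e_basis) ?rq.
have [qE|q1] := eqVneq q 1%N.
  rewrite qE lieC linearN /= (lie1_bvec law); last by lia.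
  have [p14|p14] := ltnP 14 p.+1; first by rewrite bvec_out // linear0 oppr0.
  have rp : (r == p.+1) = false by lia.
  have hp' : (0 < p.+1 < 15)%N by lia.
  by rewrite (bdual_bvec e_basis) ?rp ?oppr0.
have [pq|qp] := leqP p q.
  by rewrite -(subnKC pq) (bdual_lie law) ?strc_small //; lia.
rewrite lieC linearN /= -(subnKC (ltnW qp)) (bdual_lie law) ?strc_small ?oppr0 //; lia.
Qed.

Lemma lcs_coord j r u : u \in lcs g j -> (0 < r < 15)%N -> (r < j + 2)%N ->
  (0 < j)%N -> xi r u = 0 :> K.
Proof.
move=> uj hr rj j0.
suff /subvP/(_ u uj) : (lcs g j <= lker (xi r))%VS by rewrite memv_ker => /eqP.
case: j j0 rj {uj} => // j _ rj.
elim: j r hr rj => [|j IH] r hr rj; apply/lievP => x y xj _; rewrite memv_ker; apply/eqP.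
  by apply: (@bdual_lie_lt r x y 1) => [|i|]; lia.
apply: (@bdual_lie_lt r x y (j + 3)) => // [i hi i15|]; last by lia.
have /subvP/(_ x xj) : (lcs g j.+1 <= lker (xi i))%VS by apply: IH; lia.
by rewrite memv_ker => /eqP.
Qed.

Lemma alpha37_propC : alpha 3 7 = 0 -> propC g.
Proof.
move=> a37; apply/lievP => x y x1 y1.
have x0 i : (0 < i < 3)%N -> xi i x = 0 :> K by move=> hi; apply: (lcs_coord x1); lia.
have y0 i : (0 < i < 3)%N -> xi i y = 0 :> K by move=> hi; apply: (lcs_coord y1); lia.
have xy0 r : (0 < r < 8)%N -> xi r (lie x y) = 0 :> K.
  move=> hr; rewrite (bvec_expand e_basis x) lieEl linear_sum /= linear_sum big_nat.
  apply: big1 => p hp; rewrite linearZ linearZ /= -lieEl.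
  have [p3|p3] := ltnP p 3; first by rewrite (x0 p) ?scale0r //; lia.
  suff -> : xi r (lie (v p) y) = 0 :> K by rewrite scaler0.
  rewrite (bvec_expand e_basis y) !linear_sum big_nat; apply: big1 => q hq.
  rewrite linearZ linearZ /=.
  have [q3|q3] := ltnP q 3; first by rewrite (y0 q) ?scale0r //; lia.
  suff -> : xi r (lie (v p) (v q)) = 0 :> K by rewrite scaler0.
  wlog pq : p q hp hq p3 q3 / (p < q)%N.
    move=> H; have [pq|qp|->] := ltngtP p q; first exact: H.
      by rewrite lieC linearN /= H ?oppr0.
    by rewrite liexx linear0.
  rewrite -(subnKC (ltnW pq)) (bdual_lie law) //; [|lia..].
  have [E|rE] := ltnP r (p.*2 + (q - p)); first by rewrite strc_small //; lia.
  (* With 3 <= p < q and p + q <= r <= 7 only [e_3, e_4] along e_7 remains. *)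
  have [-> -> ->] : [/\ p = 3, q = 4 & r = 7]%N by split; lia.
  by rewrite -(bdual_lie law alpha714) // (bdual_lie_succ law).
rewrite (bvec_expand e_basis (lie x y)) big_nat; apply: rpred_sum => r hr.
have [r8|r8] := ltnP r 8; first by rewrite xy0 ?scale0r ?mem0v //; lia.
by rewrite rpredZ // bvec_lcs //; lia.
Qed.

Lemma propC_alpha37 : propC g -> alpha 3 7 = 0.
Proof.
move=> lcs6; have : lie (v 3) (v 4) \in lcs g 6.
  by apply: (subvP lcs6); apply: memv_lie; apply: bvec_lcs.
move/lcs_coord => /(_ 7 isT isT isT).
by rewrite (bdual_lie_succ law (i := 3)).
Qed.
End CentralSeries.

Theorem proposition4p6 (K : fieldType) (char0 : [pchar K] =i pred0)
  (g : lieAlgType K) (g_filiform : filiform g 14)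
  (e : 14.-tuple g) (alpha : nat -> nat -> K)
  (law_g : A14 e alpha) (alpha25 : alpha 2%N 5%N = 1) :
  [/\ A14_1 e alpha ->
        (exists2 w : bform g, Z2 w & H2_span [:: omega1 e; omega2 e; w])
        /\ ~ symplectic g,
      A14_21 e alpha ->
        (exists b : bform g,
           [/\ Z2 b, det_form e b <> 0
             & H2_span [:: omega1 e; omega2 e; b]])
        /\ symplectic g
    & A14_22 e alpha ->
        H2_span [:: omega1 e; omega2 e] /\ ~ symplectic g].
Proof.
have e_basis : basis_of {:g} e by case: law_g.
split.
- case=> _ _ /(propB_alpha714 law_g) a714 /(propC_alpha37 law_g a714) a37.
  split; last exact: flat_not_symplectic law_g a714 char0 alpha25 a37.
  (* Whether some cocycle has w(e_1, e_14) different from 0 is left undecided here; if none does,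
     the third cocycle may be 0. *)
  have [[w [Zw cw]]|noc] := classic (exists w : bform g, Z2 w /\ w (bvec e 1) (bvec e 14) <> 0).
    by exists w => //; exact: (cocycle_span3 law_g a714 char0 alpha25 Zw (or_introl cw)).
  exists 0; first exact: Z2_0.
  apply: (cocycle_span3 law_g a714 char0 alpha25 (Z2_0 g)); right=> w Zw.
  by apply: NNPP => cw; apply: noc; exists w.
- case=> -[_ _ /(propB_alpha714 law_g) a714 nC] _ aP.
  have a37 : alpha 3%N 7%N <> 0 by move=> a37; apply: nC; exact: alpha37_propC law_g a714 a37.
  have [w [Zw dw cw]] := symplectic_cocycle law_g a714 char0 alpha25 a37 aP.
  split; last by exists w => //; exact: (det_form_nondegenerate e_basis Zw.1 dw).
  by exists w; split=> //; exact: (cocycle_span3 law_g a714 char0 alpha25 Zw (or_introl cw)).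
case=> -[_ _ /(propB_alpha714 law_g) a714 nC] _ aP.
have a37 : alpha 3%N 7%N <> 0 by move=> a37; apply: nC; exact: alpha37_propC law_g a714 a37.
have c0 := cocycle_e1_e14_eq0 law_g a714 char0 alpha25 a37 aP.
split; last by move=> [w Zw]; apply: bvec14_radical law_g a714 _ Zw (c0 w Zw).
apply: H2_spanP => [w|w Zw]; last exact: cocycle_span law_g a714 char0 alpha25 _ Zw (c0 w Zw).
by rewrite !inE => /orP[]/eqP->; [exact: Z2_omega1 law_g a714|exact: Z2_omega2 law_g a714].
Qed.
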